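(* Let $m\ge 2$ be an integer and put $F_m=(m+1)(m+2)$. Every positive cubature formula of degree $2m+1$ on $S^2$, with $N$ nodes, satisfies $N\ge F_m$ and $N\ne F_m+1$. Moreover, for every integer $m\ge 3$, $$N_{2m+1}\ge F_m+2 .$$
   Context: Let $\sigma$ be the normalized (probability) surface measure on the unit sphere $S^2\subset\mathbb R^3$. A positive cubature formula of degree $t$ consists of distinct nodes $x_1,\dots,x_N\in S^2$ and weights $w_i>0$ such that $\int_{S^2} f\,d\sigma=\sum_{i=1}^N w_i f(x_i)$ for every real polynomial $f$ on $\mathbb R^3$ of total degree at most $t$. $N_t$ denotes the least possible number of nodes of a positive cubature formula of degree $t$ on $S^2$. *)

(* Defs.v *)
From HB Require Import structures.
From mathcomp Require Import all_boot all_order all_algebra.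
From mathcomp Require mpoly.

Set Implicit Arguments.
Unset Strict Implicit.
Unset Printing Implicit Defensive.

(* The notations of mpoly clash with those of the analysis library, so mpoly is
   imported in this module only, before the analysis library is loaded. *)
Module Poly3.
Import GRing.Theory mpoly.
Local Open Scope ring_scope.

Definition poly3 (R : comNzRingType) : Type := {mpoly R[3]}.

(* msize is one more than the total degree (and 0 for the zero polynomial). *)
Definition degree_le (R : comNzRingType) (t : nat) (f : poly3 R) : bool :=
  (msize f <= t.+1)%N.

Definition eval (R : comNzRingType) (f : poly3 R) (x : 3.-tuple R) : R :=
  f.@[tnth x].

End Poly3.

From mathcomp Require Import all_classical all_reals all_analysis.
From mathcomp Require Import measurable_realfun ring lra.

Import Order.TTheory GRing.Theory Num.Theory.
Import numFieldNormedType.Exports.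

Local Open Scope classical_set_scope.
Local Open Scope ring_scope.

Definition sphere2 (R : realType) : set (3.-tuple R) :=
  [set x | \sum_(i < 3) tnth x i ^+ 2 = 1].
Arguments sphere2 : clear implicits.

(* Spherical coordinates: u.1 is the polar angle, u.2 the azimuth. *)
Definition sphere_chart (R : realType) (u : R * R) : 3.-tuple R :=
  [tuple sin u.1 * cos u.2; sin u.1 * sin u.2; cos u.1].

Definition chart_domain (R : realType) : set (R * R) :=
  `[0, pi] `*` `[0, pi *+ 2].
Arguments chart_domain : clear implicits.

(* The surface element of the chart is sin(theta) dtheta dphi and the total
   area is 4 pi. *)
Definition sphere_density (R : realType) (u : R * R) : R :=
  sin u.1 / (pi *+ 4).

(* The normalized surface measure of S^2, seen as a measure on R^3 (with its
   product sigma-algebra) carried by the sphere. *)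
Definition sphere_measure (R : realType) (A : set (3.-tuple R)) : \bar R :=
  (\int[lebesgue_measure \x lebesgue_measure]_(u in
      chart_domain R `&` @sphere_chart R @^-1` A) (sphere_density u)%:E)%E.
Arguments sphere_measure : clear implicits.

Section sphere_measure_probability.
Context (R : realType).
Notation mu := (@lebesgue_measure R).

Let measurable_sin : measurable_fun setT (@sin R).
Proof. by apply: continuous_measurable_fun; exact: continuous_sin. Qed.

Let measurable_cos : measurable_fun setT (@cos R).
Proof. by apply: continuous_measurable_fun; exact: continuous_cos. Qed.

Lemma measurable_sphere_chart : measurable_fun setT (@sphere_chart R).
Proof.
have ms1 : measurable_fun setT (fun u : R * R => sin u.1).
  exact: (measurableT_comp measurable_sin).
have mc1 : measurable_fun setT (fun u : R * R => cos u.1).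
  exact: (measurableT_comp measurable_cos).
have ms2 : measurable_fun setT (fun u : R * R => sin u.2).
  exact: (measurableT_comp measurable_sin).
have mc2 : measurable_fun setT (fun u : R * R => cos u.2).
  exact: (measurableT_comp measurable_cos).
apply: (@measurable_cons _ _ _ _ (fun u => sin u.1 * cos u.2) 2
  (fun u => [tuple sin u.1 * sin u.2; cos u.1])).
  exact: measurable_funM.
apply: (@measurable_cons _ _ _ _ (fun u => sin u.1 * sin u.2) 1
  (fun u => [tuple cos u.1])).
  exact: measurable_funM.
exact: (@measurable_cons _ _ _ _ (fun u => cos u.1) 0 (fun=> [tuple])).
Qed.

Lemma measurable_chart_domain : measurable (chart_domain R).
Proof. exact: measurableX. Qed.

Lemma sphere_density_ge0 (u : R * R) :
  chart_domain R u -> 0 <= sphere_density u.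
Proof.
case=> /=; rewrite in_itv/= => u1 _.
by rewrite divr_ge0// ?sin_ge0_pi// mulrn_wge0// pi_ge0.
Qed.

Lemma measurable_sphere_density : measurable_fun setT (@sphere_density R).
Proof.
apply: measurable_funM => //.
exact: (measurableT_comp measurable_sin).
Qed.

Let sphere_measure0 : sphere_measure R set0 = 0%E.
Proof. by rewrite /sphere_measure preimage_set0 setI0 integral_set0. Qed.

Let sphere_measure_ge0 A : (0 <= sphere_measure R A)%E.
Proof.
by apply: integral_ge0 => u [Du _]; rewrite lee_fin sphere_density_ge0.
Qed.

Let sphere_measure_sigma_additive : semi_sigma_additive (sphere_measure R).
Proof.
move=> /= F mF tF mUF; rewrite /sphere_measure; apply: cvg_toP.
  apply: ereal_nondecreasing_is_cvgn => m n mn.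
  apply: lee_sum_nneg_natr => // k _ _.
  by apply: integral_ge0 => u [Du _]; rewrite lee_fin sphere_density_ge0.
rewrite preimage_bigcup setI_bigcupr ge0_integral_bigcup//=.
- move=> k; apply: measurableI; first exact: measurable_chart_domain.
  by rewrite -[X in measurable X]setTI; exact: measurable_sphere_chart.
- apply: measurable_funTS; apply: measurableT_comp => //.
  exact: measurable_sphere_density.
- by move=> u [k _ [Du _]]; rewrite lee_fin sphere_density_ge0.
- apply/trivIsetP => i j _ _ ij.
  rewrite setIACA setIid -preimage_setI.
  by move/trivIsetP : tF => /(_ i j Logic.I Logic.I ij) ->; rewrite preimage_set0 setI0.
Qed.

HB.instance Definition _ := isMeasure.Build _ _ _ (sphere_measure R)
  sphere_measure0 sphere_measure_ge0 sphere_measure_sigma_additive.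

Let sphere_measure_setT : sphere_measure R [set: _] = 1%E.
Proof.
have pi4_gt0 : 0 < (pi : R) *+ 4 by rewrite mulrn_wgt0// pi_gt0.
rewrite /sphere_measure preimage_setT setIT integral_mkcond.
rewrite fubini_tonelli1//=; first last.
- by move=> u; rewrite patchE; case: ifPn => // /set_mem Du;
    rewrite lee_fin sphere_density_ge0.
- apply/(measurable_restrictT _ measurable_chart_domain).
  apply: measurable_funTS; apply: measurableT_comp => //.
  exact: measurable_sphere_density.
rewrite /fubini_F.
transitivity (\int[mu]_(x in `[0%R, pi]) (sin x / 2)%:E)%E.
  rewrite [RHS]integral_mkcond; apply: eq_integral => x _.
  rewrite patchE; case: ifPn => [/set_mem/= x0pi|/negP x0pi].
    transitivity (\int[mu]_(y in `[0%R, (pi *+ 2)%R]) (sin x / (pi *+ 4))%:E)%E.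
      rewrite [RHS]integral_mkcond; apply: eq_integral => y _.
      rewrite !patchE; congr (if _ then _ else _).
      by apply/idP/idP => [/set_mem[_ ?]|/set_mem ?]; exact/mem_set.
    rewrite integral_cst//= lebesgue_measure_itv/= lte_fin mulrn_wgt0 ?pi_gt0//.
    rewrite -EFinD -EFinM subr0; congr (_%:E).
    have : (pi : R) != 0 by rewrite gt_eqF// pi_gt0.
    by move: (pi : R) => p p0; field.
  rewrite integral0_eq// => y _; rewrite patchE; case: ifPn => // /set_mem[/= h _].
  by case: x0pi; exact/mem_set.
rewrite (@continuous_FTC2 _ _ (fun x => - cos x / 2) 0 pi) ?pi_gt0//.
- rewrite cospi cos0 -EFinB; congr (_%:E); lra.
- apply: continuous_subspaceT => x.
  by apply: cvgM; [exact: continuous_sin|exact: cvg_cst].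
- have dc x : derivable (fun x : R => - cos x / 2) x 1 by [].
  have cc x : {for x, continuous (fun x : R => - cos x / 2)}.
    exact/differentiable_continuous/derivable1_diffP/dc.
  split.
  + by move=> x _; exact: dc.
  + exact/cvg_at_right_filter/cc.
  + exact/cvg_at_left_filter/cc.
- move=> x _; rewrite derive1E; apply: derive_val.
  by apply: is_derive_eq; rewrite /GRing.scale/=; lra.
Qed.

HB.instance Definition _ := @Measure_isProbability.Build _ _ R
  (sphere_measure R) sphere_measure_setT.

Lemma sphere_measure_sphere2 : sphere_measure R (sphere2 R) = 1%E.
Proof.
rewrite -sphere_measure_setT /sphere_measure; congr (integral _ _ _).
congr (_ `&` _); rewrite preimage_setT; apply/seteqP; split=> // -[a b] _ /=.
rewrite /sphere2/= !big_ord_recl big_ord0 /= /tnth/=.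
have := cos2Dsin2 a; have := cos2Dsin2 b; nra.
Qed.

End sphere_measure_probability.

Definition positive_cubature (R : realType) (t N : nat)
    (x : 'I_N -> 3.-tuple R) (w : 'I_N -> R) : Prop :=
  [/\ injective x,
      forall i, sphere2 R (x i),
      forall i, 0 < w i
    & forall f : Poly3.poly3 R, Poly3.degree_le t f ->
        (\int[sphere_measure R]_(y in sphere2 R) (Poly3.eval f y)%:E
         = (\sum_(i < N) w i * Poly3.eval f (x i))%:E)%E].

(* The set of node counts is a nonempty set of natural numbers (positive
   cubature formulas exist in every degree), so this infimum is attained: it is
   the least number of nodes. *)
Definition min_nodes (R : realType) (t : nat) : \bar R :=
  ereal_inf [set (N%:R)%:E | N in
    [set N : nat | exists x w, @positive_cubature R t N x w]].
Arguments min_nodes : clear implicits.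

Definition node_bound (m : nat) : nat := ((m + 1) * (m + 2))%N.

(* Main.v *)
(* Write d = (m+1)(m+2)/2 for the dimension of the space Hom_m of forms of
   degree m in three variables.  For a positive formula of degree 2m+1 with
   nodes x_i, evaluation at the nodes maps Hom_m onto a d-dimensional subspace U
   of R^N, orthogonal for the weights to the image V of Hom_(m+1), since odd
   forms integrate to 0.  If p is a linear form vanishing at no node then
   p U <= V, hence N >= 2d.

   When N <= 2d+1, U has codimension at most 1 in p^-1 V, a space which contains
   (q/p) U for every linear form q; and the multiplications by q/p commute.  So
   either some space between U and p^-1 V is stable under all of them, or
   exactly one pencil of them preserves U.  In the first case the space contains
   the functions p^m 1_l, where l is the set of nodes on a line through the
   origin; orthogonality then shows that the nodes come in antipodal pairs of
   equal weight, so N is even.  In the second case the same holds for the nodes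
   off one great circle; a form of degree m vanishing at all nodes except +-x_i
   is a multiple of the reproducing kernel of Hom_m at x_i, hence zonal, hence
   not identically 0 on the circle, and reducing modulo it contradicts the fact
   that multiplication by q/p does not preserve the functions of U carried by
   the circle.

   If N = 2d, all weights are equal and the inner products of nonproportional
   nodes are roots of a fixed polynomial of degree m.  Let t be the largest
   inner product of distinct nodes, attained at x_i and x_j.  Testing against
   polynomials vanishing at the other latitudes around x_i shows that, for
   m >= 3, the nodes at latitude t form a spherical 5-design on their circle, so
   two of them are at angle at most pi/3 on it; this makes their inner product
   exceed t. *)

Require Import Defs.
From HB Require Import structures.
From mathcomp Require Import all_boot all_order all_algebra.
From mathcomp Require Import zify ring lra.
From mathcomp Require mpoly.

Set Implicit Arguments.
Unset Strict Implicit.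
Unset Printing Implicit Defensive.

Import Order.TTheory GRing.Theory Num.Theory.

Local Open Scope ring_scope.

(** * Subspaces of [R^N] and multiplication by a vector *)

Section Pointwise.
Variables (F : fieldType) (N : nat).
Implicit Types (T u v : 'rV[F]_N) (U M S : {vspace 'rV[F]_N}) (P Q : pred 'I_N).

Definition pw T u : 'rV[F]_N := u *m diag_mx T.
Definition restr P : 'rV[F]_N -> 'rV[F]_N := pw (\row_i (P i)%:R).
Definition pw_stable T U : bool := (linfun (mulmxr (diag_mx T)) @: U <= U)%VS.

Lemma pwE T u i : pw T u 0 i = T 0 i * u 0 i.
Proof. by rewrite /pw mul_mx_diag mxE mulrC. Qed.

Lemma restrE P u i : restr P u 0 i = if P i then u 0 i else 0.
Proof. by rewrite pwE mxE; case: (P i); rewrite ?mul1r ?mul0r. Qed.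

Lemma pwDr T u v : pw T (u + v) = pw T u + pw T v.
Proof. exact: mulmxDl. Qed.

Lemma pwZr T a u : pw T (a *: u) = a *: pw T u.
Proof. by rewrite /pw -scalemxAl. Qed.

Lemma pw_sum T (r : seq F) (f : F -> 'rV[F]_N) :
  pw T (\sum_(c <- r) f c) = \sum_(c <- r) pw T (f c).
Proof. exact: mulmx_suml. Qed.

Lemma pwBr T u v : pw T (u - v) = pw T u - pw T v.
Proof. exact: mulmxBl. Qed.

Lemma rowDE u v i : (u + v) 0 i = u 0 i + v 0 i.
Proof. exact: mxE. Qed.

Lemma rowBE u v i : (u - v) 0 i = u 0 i - v 0 i.
Proof. by rewrite !mxE. Qed.

Lemma rowZE a u i : (a *: u) 0 i = a * u 0 i.
Proof. exact: mxE. Qed.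

Lemma pwDl T T' u : pw (T + T') u = pw T u + pw T' u.
Proof. by apply/rowP => i; rewrite rowDE !pwE rowDE mulrDl. Qed.

Lemma pwZl T a u : pw (a *: T) u = a *: pw T u.
Proof. by apply/rowP => i; rewrite rowZE !pwE rowZE mulrA. Qed.

Lemma pwC T T' u : pw T (pw T' u) = pw T' (pw T u).
Proof. by apply/rowP => i; rewrite !pwE mulrCA. Qed.

Lemma restr_sum T u : u = \sum_(c <- undup (codom (T 0))) restr (fun j => T 0 j == c) u.
Proof.
apply/rowP => j; rewrite summxE (bigD1_seq (T 0 j)) ?undup_uniq//=; last first.
  by rewrite mem_undup codom_f.
rewrite restrE eqxx big1 ?addr0// => c; rewrite restrE eq_sym.
by move/negbTE->.
Qed.

Lemma pw_stableP T U : reflect (forall u, u \in U -> pw T u \in U) (pw_stable T U).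
Proof.
apply: (iffP subvP) => [TU u uU|TU _ /memv_imgP[u uU ->]].
  by have := TU _ (memv_img (linfun (mulmxr (diag_mx T))) uU); rewrite lfunE.
by rewrite lfunE; exact: TU.
Qed.

Lemma pw_stablePn T U :
  reflect (exists2 u, u \in U & pw T u \notin U) (~~ pw_stable T U).
Proof.
apply: (iffP idP) => [/subvPn[_ /memv_imgP[u uU ->]]|[u uU Tu]].
  by rewrite lfunE => Tu; exists u.
apply/subvPn; exists (pw T u) => //; apply/memv_imgP; exists u => //; by rewrite lfunE.
Qed.

(** Restriction to the fibre of [T] over [c] is a Lagrange polynomial in the multiplier [T], and a
    stable space is closed under polynomials in [T]. *)
Lemma restr_stable T U c u : pw_stable T U -> u \in U ->
  restr (fun j => T 0 j == c) u \in U.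
Proof.
move=> /pw_stableP TU uU.
pose s := [seq T 0 j | j <- enum 'I_N & T 0 j != c].
have cs : c \notin s by apply/mapP => -[j]; rewrite mem_filter => /andP[/eqP + _] cE; apply.
pose p : {poly F} := \prod_(y <- s) ((c - y)^-1 *: ('X - y%:P)).
have pU (r : seq F) : pw (\row_j (\prod_(y <- r) ((c - y)^-1 *: ('X - y%:P))).[T 0 j]) u \in U.
  elim: r => [|y r IH].
    rewrite (_ : pw _ _ = u)//; apply/rowP => j.
    by rewrite pwE mxE big_nil hornerC mul1r.
  set v := pw _ u in IH; have : (c - y)^-1 *: (pw T v - y *: v) \in U.
    by rewrite memvZ// memvB ?TU// memvZ.
  congr (_ \in U); apply/rowP => j.
  rewrite [RHS]pwE [in RHS]mxE big_cons hornerM hornerZ hornerXsubC.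
  by rewrite rowZE rowBE rowZE pwE /v pwE mxE; ring.
have := pU s; congr (_ \in U); apply/rowP => j; rewrite pwE restrE mxE horner_prod.
case: eqP => [Tj|/eqP Tj].
  rewrite big_seq big1 ?mul1r// => y ys.
  rewrite hornerZ hornerXsubC Tj mulVf// subr_eq0.
  by apply: contraNneq cs => ->.
rewrite (big_rem (T 0 j))/=; last first.
  by apply/mapP; exists j => //; rewrite mem_filter Tj mem_enum.
by rewrite hornerZ hornerXsubC subrr mulr0 !mul0r.
Qed.

Lemma restr_class_stable T1 T2 U i u : pw_stable T1 U -> pw_stable T2 U -> u \in U ->
  restr (fun j => (T1 0 j == T1 0 i) && (T2 0 j == T2 0 i)) u \in U.
Proof.
move=> T1U T2U uU.
have := restr_stable (T2 0 i) T2U (restr_stable (T1 0 i) T1U uU).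
by congr (_ \in U); apply/rowP => j; rewrite !restrE -if_and andbC.
Qed.

Lemma mem_codim1 U M e y : (U <= M)%VS -> (\dim M <= (\dim U).+1)%N ->
  e \in M -> e \notin U -> y \in M -> exists a, y - a *: e \in U.
Proof.
move=> UM dM eM eU yM.
have UeM : (U + <[e]> <= M)%VS by rewrite subv_add UM -memvE.
have : (U + <[e]>)%VS == M.
  rewrite eqEdim UeM (leq_trans dM)// dimv_disjoint_sum.
    by rewrite dim_vline addnC; case: eqVneq eU => // ->; rewrite mem0v.
  apply/eqP; rewrite -subv0; apply/subvP => x /memv_capP[xU /vlineP[a xE]].
  rewrite memv0 xE; have [->|a0] := eqVneq a 0; first by rewrite scale0r.
  by case/negP: eU; rewrite -(scalerK a0 e) -xE memvZ.
move/eqP => UE; move: yM; rewrite -UE => /memv_addP[x xU [_ /vlineP[a ->] ->]].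
by exists a; rewrite addrK.
Qed.

(* When neither multiplier preserves [U], write [T1 f] and [T g] for elements
   generating [M] modulo [U] with [T f, T1 g \in U]; since the multipliers
   commute, [T (T1 f) = T1 (T f)] and [T1 (T g) = T (T1 g)] stay in [M]. *)
Lemma stable_dichotomy U M T1 T2 : (U <= M)%VS -> (\dim M <= (\dim U).+1)%N ->
  (forall u, u \in U -> pw T1 u \in M) -> (forall u, u \in U -> pw T2 u \in M) ->
  (exists S, [/\ (U <= S)%VS, (S <= M)%VS, pw_stable T1 S & pw_stable T2 S]) \/
  (exists a b a' b', [/\ a * b' - a' * b != 0, pw_stable (a *: T1 + b *: T2) U &
     exists2 v, v \in U & pw (a' *: T1 + b' *: T2) v \notin U]).
Proof.
move=> UM dM T1M T2M.
have [T1U|/pw_stablePn[f fU fT1]] := boolP (pw_stable T1 U).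
  have [T2U|/pw_stablePn[v vU vT2]] := boolP (pw_stable T2 U).
    by left; exists U.
  right; exists 1, 0, 0, 1; rewrite !scale1r !scale0r addr0 add0r.
  by rewrite mulr1 mulr0 subr0 oner_eq0; split=> //; exists v.
have [t tU] := mem_codim1 UM dM (T1M _ fU) fT1 (T2M _ fU).
(* The member of the pencil that sends [f] into [U]. *)
pose T := - t *: T1 + 1 *: T2.
have TE u : pw T u = pw T2 u - t *: pw T1 u.
  by rewrite pwDl !pwZl scale1r scaleNr addrC.
have TM u : u \in U -> pw T u \in M.
  by move=> uU; rewrite TE memvB ?memvZ ?T1M ?T2M.
have [TU|/pw_stablePn[g gU gT]] := boolP (pw_stable T U).
  right; exists (- t), 1, 1, 0; split => //.
    by rewrite mulr0 mulr1 sub0r oppr_eq0 oner_eq0.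
  by exists f; rewrite ?scale1r ?scale0r ?addr0.
have [s sU] := mem_codim1 UM dM (T1M _ fU) fT1 (T1M _ gU).
have fTU : pw T f \in U by rewrite TE.
(* Subtracting a multiple of [f] brings [T1 g'] into [U]; since [T f] is in [U], [T g'] stays
   outside. So [T1 f] and [T g'] each generate [M] modulo [U]. *)
pose g' := g - s *: f.
have g'U : g' \in U by rewrite memvB ?memvZ.
have g'T1 : pw T1 g' \in U by rewrite pwBr pwZr.
have g'T : pw T g' \notin U by rewrite pwBr pwZr rpredBr ?memvZ.
have sT1 y : y \in M -> pw T1 y \in M.
  move=> yM; have [a yE] := mem_codim1 UM dM (TM _ g'U) g'T yM.
  rewrite -(subrK (a *: pw T g') y) pwDr memvD ?(T1M _ yE)// pwZr memvZ// pwC.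
  exact: TM.
have sT y : y \in M -> pw T y \in M.
  move=> yM; have [a yE] := mem_codim1 UM dM (T1M _ fU) fT1 yM.
  rewrite -(subrK (a *: pw T1 f) y) pwDr memvD ?(TM _ yE)// pwZr memvZ// pwC.
  exact: T1M.
left; exists M; split => //; apply/pw_stableP => y yM; first exact: sT1.
by rewrite -(subrK (t *: pw T1 y) (pw T2 y)) -TE memvD ?sT// memvZ ?sT1.
Qed.

(** Some fibre component of [v], say over [c], still leaves [U] under [T'], and its image generates
    [M] modulo [U]. For [y] in [U] carried by another fibre, [T' y] is thus in [U] up to a function
    carried by the fibre over [c]; restricting to the fibre of [y] removes that function. *)
Lemma stable_off_fibre U M T T' v : (U <= M)%VS -> (\dim M <= (\dim U).+1)%N ->
  pw_stable T U -> (forall u, u \in U -> pw T' u \in M) ->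
  v \in U -> pw T' v \notin U ->
  exists c, (exists v0, [/\ v0 \in U, pw T' v0 \notin U &
                          forall j, T 0 j != c -> v0 0 j = 0]) /\
    (forall i u, T 0 i != c -> u \in U ->
       restr (fun j => (T 0 j == T 0 i) && (T' 0 j == T' 0 i)) u \in U).
Proof.
move=> UM dM TU T'M vU vT'.
pose R c u := restr (fun j => T 0 j == c) u.
have [c cU] : exists c, pw T' (R c v) \notin U.
  have [/allP vcU|/allPn[c _ cU]] :=
    boolP (all (fun c => pw T' (R c v) \in U) (undup (codom (T 0)))); last by exists c.
  by case/negP: vT'; rewrite (restr_sum T v) pw_sum big_seq rpred_sum.
have cvU := restr_stable c TU vU.
exists c; split.
  by exists (R c v); split => // j; rewrite restrE => /negbTE->.
move=> i u ic uU; pose S := (linfun (mulmxr (diag_mx (\row_j (T 0 j == T 0 i)%:R))) @: U)%VS.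
have SE y : y \in S = (y \in U) && (R (T 0 i) y == y).
  apply/memv_imgP/andP => [[z zU ->]|[yU /eqP yE]].
    rewrite lfunE -/(pw _ z) -/(R _ z); split; first exact: restr_stable.
    by apply/eqP/rowP => j; rewrite !restrE; case: eqP.
  by exists y => //; rewrite lfunE.
have ST' : pw_stable T' S.
  apply/pw_stableP => y; rewrite !SE => /andP[yU /eqP yE].
  have T'y : R (T 0 i) (pw T' y) = pw T' y by rewrite /R /restr pwC -/(restr _ _) -/(R _ _) yE.
  rewrite T'y eqxx andbT.
  have [a aU] := mem_codim1 UM dM (T'M _ cvU) cU (T'M _ yU).
  have := restr_stable (T 0 i) TU aU; congr (_ \in U); rewrite -[RHS]T'y.
  apply/rowP => j; rewrite !restrE; case: eqP => // Tj.
  by rewrite rowBE rowZE (pwE _ y) (pwE T') /R restrE Tj (negbTE ic) mulr0 mulr0 subr0.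
have uS : R (T 0 i) u \in S.
  rewrite SE restr_stable//=; apply/eqP/rowP => j; rewrite !restrE; by case: eqP.
have := restr_stable (T' 0 i) ST' uS; rewrite SE => /andP[+ _].
by congr (_ \in U); apply/rowP => j; rewrite !restrE -if_and andbC.
Qed.

End Pointwise.

(** * Forms in three variables and positive formulas *)

Module SphereForms.
Import mpoly.

Section Forms.
Variable R : rcfType.
Implicit Types (f g h : {mpoly R[3]}) (u v : 'rV[R]_3) (k : {poly R}).

Definition dot u v : R := \sum_i u 0 i * v 0 i.
Definition ev f u : R := f.@[u 0].
Definition lin u : {mpoly R[3]} := \sum_i u 0 i *: 'X_i.
Definition dirder u f : {mpoly R[3]} := \sum_i u 0 i *: f^`M(i).
Definition nrm2 : {mpoly R[3]} := \sum_(i < 3) 'X_i * 'X_i.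
Definition zonal v k : {mpoly R[3]} := horner_alg (lin v) k.

Lemma dotC u v : dot u v = dot v u.
Proof. by apply: eq_bigr => i _; rewrite mulrC. Qed.

Lemma dotDr u v w : dot u (v + w) = dot u v + dot u w.
Proof. by rewrite /dot -big_split; apply: eq_bigr => i _; rewrite mxE mulrDr. Qed.

Lemma dotZr u a v : dot u (a *: v) = a * dot u v.
Proof. by rewrite /dot mulr_sumr; apply: eq_bigr => i _; rewrite mxE mulrCA. Qed.

Lemma dotNr u v : dot u (- v) = - dot u v.
Proof. by rewrite -scaleN1r dotZr mulN1r. Qed.

Lemma dotDl u v w : dot (u + v) w = dot u w + dot v w.
Proof. by rewrite dotC dotDr !(dotC w). Qed.

Lemma dotZl a u v : dot (a *: u) v = a * dot u v.
Proof. by rewrite dotC dotZr dotC. Qed.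

Lemma dotNl u v : dot (- u) v = - dot u v.
Proof. by rewrite dotC dotNr dotC. Qed.

Lemma dotv_ge0 u : 0 <= dot u u.
Proof. by apply: sumr_ge0 => i _; rewrite -expr2 sqr_ge0. Qed.

Lemma dotv_eq0 u : (dot u u == 0) = (u == 0).
Proof.
apply/eqP/eqP => [uu0|->]; last by rewrite -(scale0r 0) dotZl mul0r.
apply/rowP => i; rewrite mxE; apply/eqP; rewrite -sqrf_eq0 expr2.
by apply/eqP; apply: (psumr_eq0P _ uu0) => // j _; rewrite -expr2 sqr_ge0.
Qed.

Lemma ev_lin u v : ev (lin u) v = dot u v.
Proof.
by rewrite /ev /lin raddf_sum; apply: eq_bigr => i _; rewrite /= mevalZ mevalXU.
Qed.

Lemma evM f g u : ev (f * g) u = ev f u * ev g u.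
Proof. exact: mevalM. Qed.

Lemma evX f n u : ev (f ^+ n) u = ev f u ^+ n.
Proof. by rewrite /ev rmorphXn. Qed.

Lemma evD f g u : ev (f + g) u = ev f u + ev g u.
Proof. exact: mevalD. Qed.

Lemma evB f g u : ev (f - g) u = ev f u - ev g u.
Proof. exact: mevalB. Qed.

Lemma evZ a f u : ev (a *: f) u = a * ev f u.
Proof. exact: mevalZ. Qed.

Lemma ev_zonal v k u : ev (zonal v k) u = k.[dot v u].
Proof.
rewrite /zonal.
elim/poly_ind: k => [|k c IH].
  by rewrite raddf0 horner0; exact: meval0.
rewrite rmorphD rmorphM/= horner_algX horner_algC evD evM IH ev_lin.
by rewrite hornerMXaddC /ev alg_mpolyC mevalC.
Qed.

Lemma zonal0 v : zonal v 0 = 0.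
Proof. exact: rmorph0. Qed.

Lemma zonal1 v : zonal v 1 = 1.
Proof. exact: rmorph1. Qed.

Lemma zonalD v : {morph zonal v : k1 k2 / k1 + k2}.
Proof. exact: rmorphD. Qed.

Lemma zonalM v : {morph zonal v : k1 k2 / k1 * k2}.
Proof. exact: rmorphM. Qed.

Lemma zonalZ v a k : zonal v (a *: k) = a *: zonal v k.
Proof. by rewrite -mul_polyC zonalM /zonal horner_algC mulr_algl. Qed.

Lemma zonalX v : zonal v 'X = lin v.
Proof. exact: horner_algX. Qed.

Lemma zonalXn v j : zonal v 'X^j = lin v ^+ j.
Proof. by rewrite /zonal rmorphXn/= horner_algX. Qed.

Lemma lin_homog u : lin u \is 1.-homog.
Proof.
by apply: rpred_sum => i _; apply: rpredZ; rewrite dhomogX /= mdeg1.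
Qed.

Lemma nrm2_homog : nrm2 \is 2.-homog.
Proof.
by apply: rpred_sum => i _; apply: (@dhomogM _ _ _ 1 _ 1); rewrite dhomogX /= mdeg1.
Qed.

Lemma mderiv_homog i g n : g \is n.-homog -> g^`M(i) \is n.-1.-homog.
Proof.
move=> /dhomogP gn; apply/dhomogP => m; rewrite mcoeff_msupp mcoeff_mderiv => gm.
have : (m + U_(i))%MM \in msupp g.
  by rewrite mcoeff_msupp; apply: contraNneq gm => ->; rewrite mul0rn.
by move/gn; rewrite /= mdegD mdeg1 addn1 => <-.
Qed.

Lemma mderiv_homog0 i g : g \is 0.-homog -> g^`M(i) = 0.
Proof.
move=> /dhomogP g0; apply/mpolyP => m; rewrite mcoeff_mderiv mcoeff0.
have [/g0|] := boolP ((m + U_(i))%MM \in msupp g).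
  by rewrite /= mdegD mdeg1 addn1.
by rewrite mcoeff_msupp negbK => /eqP->; rewrite mul0rn.
Qed.

Lemma dirder_homog v g n : g \is n.-homog -> dirder v g \is n.-1.-homog.
Proof. by move=> gn; apply: rpred_sum => i _; apply: rpredZ; apply: mderiv_homog. Qed.

Lemma euler g n : g \is n.-homog -> \sum_i 'X_i * g^`M(i) = n%:R *: g.
Proof.
move=> /dhomogP gn; rewrite [in RHS](mpolyE g) scaler_sumr.
have -> : \sum_i 'X_i * g^`M(i) =
    \sum_(m <- msupp g) \sum_i 'X_i * (g@_m *: 'X_[m])^`M(i).
  rewrite exchange_big/=; apply: eq_bigr => i _.
  rewrite {1}(mpolyE g) raddf_sum/= mulr_sumr; exact: eq_bigr.
rewrite big_seq [RHS]big_seq; apply: eq_bigr => m /gn <-.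
rewrite /= mdegE natr_sum scaler_suml; apply: eq_bigr => i _.
rewrite mderivZ mderivX -!scalerAr !scalerA mulrC -mpolyXD.
have [->|mi0] := eqVneq (m i) 0%N; first by rewrite !mul0r !scale0r.
by rewrite addmC submK// lep1mP.
Qed.

Lemma dirder_ev v g n : g \is n.-homog -> ev (dirder v g) v = n%:R * ev g v.
Proof.
move=> /euler gE; rewrite -evZ -gE /ev !raddf_sum; apply: eq_bigr => i _ /=.
by rewrite mevalZ mevalM mevalXU.
Qed.

Lemma dirderM v f g : dirder v (f * g) = dirder v f * g + f * dirder v g.
Proof.
rewrite /dirder mulr_suml mulr_sumr -big_split/=; apply: eq_bigr => i _.
by rewrite mderivM scalerDr scalerAl scalerAr.
Qed.

Lemma mnmBB (a : 'X_{1..3}) : (a - a)%MM = 0%MM.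
Proof. by apply/mnmP => j; rewrite mnmBE mnm0E subnn. Qed.

Lemma mderiv_lin i u : (lin u)^`M(i) = (u 0 i)%:MP.
Proof.
rewrite /lin raddf_sum (bigD1 i)//= big1 ?addr0 => [|j ji].
  by rewrite mderivZ mderivX mnm1E eqxx scale1r mnmBB mpolyX0 -alg_mpolyC.
by rewrite mderivZ mderivX mnm1E (negbTE ji) scale0r scaler0.
Qed.

Lemma dirder_lin v u : dirder v (lin u) = (dot v u)%:MP.
Proof.
rewrite /dirder /dot raddf_sum; apply: eq_bigr => i _ /=.
by rewrite mderiv_lin mpolyCM mul_mpolyC.
Qed.

Lemma dirder_linX v u n : dirder v (lin u ^+ n) = (n%:R * dot v u) *: lin u ^+ n.-1.
Proof.
elim: n => [|n IH].
  rewrite expr0 mul0r scale0r /dirder big1// => i _.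
  by rewrite -(mpolyX0 _ R) mderivX mnm0E scale0r scaler0.
rewrite exprS dirderM IH dirder_lin mul_mpolyC -scalerAr; case: n {IH} => [|n].
  by rewrite !mul0r scale0r addr0 mul1r.
by rewrite /= -exprS -scalerDl [in RHS]mulrSr mulrDl mul1r addrC.
Qed.

(** * Integration over the sphere as a functional on polynomials *)

Section SphereFunctional.
Variable I : {scalar {mpoly R[3]}}.
Hypothesis I1 : I 1 = 1.
(* Integration by parts on the sphere; with [I1] it determines [I]. *)
Hypothesis IX : forall i n g, g \is n.-homog ->
  n.+2%:R * I ('X_i * g) = I g^`M(i).

Lemma I_lin v n g : g \is n.-homog -> n.+2%:R * I (lin v * g) = I (dirder v g).
Proof.
move=> gn; rewrite /lin mulr_suml !raddf_sum/= mulr_sumr; apply: eq_bigr => i _.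
by rewrite -scalerAl !linearZ/= -(IX i gn) mulrCA.
Qed.

(** On a monomial of degree d, integration by parts produces the factor d + 3 on both sides: Euler's
    identity contributes d and the three coordinates contribute 3. So [I] kills the multiples of
    |x|^2 - 1. *)
Lemma I_nrm2 f : I (nrm2 * f) = I f.
Proof.
rewrite (mpolyE f) mulr_sumr !raddf_sum; apply: eq_bigr => m _ /=.
rewrite -scalerAr !linearZ/=; congr (_ * _).
have Xm : 'X_[R, m] \is (mdeg m).-homog by rewrite dhomogX.
apply: (@mulfI _ (mdeg m).+3%:R); first by rewrite pnatr_eq0.
rewrite /nrm2 mulr_suml raddf_sum/= mulr_sumr.
under eq_bigr => i _.
  have XXm : 'X_i * 'X_[R, m] \is (mdeg m).+1.-homog.
    by apply: (@dhomogM _ _ _ 1) => //; rewrite dhomogX /= mdeg1.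
  rewrite -mulrA (IX i XXm) mderivM mderivX mnm1E eqxx scale1r.
  rewrite mnmBB mpolyX0 mul1r.
  over.
rewrite /= -raddf_sum big_split/= (euler Xm) sumr_const card_ord.
by rewrite -scaler_nat -scalerDl linearZ/= -natrD.
Qed.

(** Induction on the degree. By integration by parts each partial derivative of [g] is orthogonal to
    the forms of its own degree, where the term in the derivative of [h] is lifted to the degree of
    [g] by a factor [nrm2]. The derivatives vanish, and Euler's identity gives g = 0. *)
Lemma I_nondeg n g : g \is n.-homog ->
  (forall h, h \is n.-homog -> I (g * h) = 0) -> g = 0.
Proof.
elim: n g => [|n IH] g gn g0.
  have gE : g = (g@_0)%:MP.
    apply/mpolyP => m; rewrite mcoeffC; have [->|m0] := eqVneq 0%MM m.
      by rewrite mulr1.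
    rewrite mulr0; apply: (dhomog_nemf_coeff gn).
    by rewrite /= mdeg_eq0 eq_sym.
  have := g0 1 (dhomog1 _ _); rewrite mulr1 gE -alg_mpolyC linearZ/= I1 mulr1.
  by move=> ->; rewrite scale0r.
have dg0 i : g^`M(i) = 0.
  apply: IH => [|h hn]; first exact: mderiv_homog gn.
  have ghn : g * h \is (n.+1 + n).-homog by apply: dhomogM.
  have Xhn : 'X_i * h \is n.+1.-homog.
    by apply: (@dhomogM _ _ _ 1) => //; rewrite dhomogX /= mdeg1.
  have := IX i ghn; rewrite mderivM raddfD/= mulrCA (g0 ('X_i * h))// mulr0.
  have -> : I (g * h^`M(i)) = 0.
    rewrite -I_nrm2 mulrCA; case: n {gn ghn Xhn} hn g0 => [|n] hn g0.
      by rewrite (mderiv_homog0 _ hn) !mulr0 raddf0.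
    rewrite g0//; apply: (@dhomogM _ _ _ 2); first exact: nrm2_homog.
    exact: mderiv_homog hn.
  by rewrite addr0 => <-.
apply/eqP; move/eqP: (euler gn); rewrite big1 => [|i _]; last by rewrite dg0 mulr0.
by rewrite eq_sym scaler_eq0 pnatr_eq0.
Qed.

Lemma linX_homog v j : lin v ^+ j \is j.-homog.
Proof. by have := dhomogMn j (lin_homog v); rewrite mul1n. Qed.

(** The polynomial on the right is the adjoint of differentiation along [v], applied to [k]. For [k]
    a power of the variable it comes from integrating [lin v ^+ i * g] by parts. *)
Lemma I_zonal_dirder v n g k : dot v v = 1 -> g \is n.+1.-homog ->
  I (zonal v k * dirder v g) =
  I (zonal v (n.+3%:R *: ('X * k) + ('X^2 - 1) * k^`()) * g).
Proof.
move=> v1 gn; rewrite -(coefK k) poly_def.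
elim/big_ind: _ => [|k1 k2 H1 H2|i _].
- by rewrite deriv0 !mulr0 scaler0 addr0 zonal0 !mul0r.
- have -> : n.+3%:R *: ('X * (k1 + k2)) + ('X^2 - 1) * (k1 + k2)^`() =
      (n.+3%:R *: ('X * k1) + ('X^2 - 1) * k1^`()) +
      (n.+3%:R *: ('X * k2) + ('X^2 - 1) * k2^`()) :> {poly R}.
    by rewrite derivD !(mulrDr _ k1, mulrDr _ k1^`()) scalerDr addrACA.
  by rewrite (zonalD v k1) (zonalD v (_ + _)) 2!mulrDl 2!raddfD/= H1 H2.
case: i => i _ /=; move: (k`_i) => a.
rewrite [X in _ = I (zonal v X * g)](_ : _ =
    a *: (n.+3%:R *: ('X * 'X^i) + ('X^2 - 1) * ('X^i)^`())); last first.
  rewrite derivZ -!mul_polyC; ring.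
rewrite !(zonalZ _ a) -!scalerAl !linearZ/=; congr (_ * _).
have gih : lin v ^+ i * g \is (i + n.+1).-homog by apply: dhomogM (linX_homog v i) gn.
have := I_lin v gih.
rewrite dirderM dirder_linX v1 mulr1 raddfD/= -scalerAl linearZ/= zonalXn => H.
apply: (addrI (i%:R * I (lin v ^+ i.-1 * g))); rewrite -H mulrA -exprS.
rewrite derivXn zonalD zonalZ zonalM zonalX zonalXn -exprS.
rewrite [in RHS]mulrDl raddfD/=.
rewrite -scalerAl linearZ/=.
case: i {gih H} => [|i] /=.
  by rewrite mulr0n mulr0 zonal0 !mul0r raddf0 add0r addr0.
have -> : ('X^2 - 1) * ('X^i *+ i.+1) = i.+1%:R *: ('X^(i.+2) - 'X^i) :> {poly R}.
  by rewrite scaler_nat mulrnAr mulrBl mul1r -exprD.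
rewrite zonalZ zonalD -[X in zonal v (- X)]scale1r -scaleNr zonalZ !zonalXn scaleN1r.
rewrite -scalerAl linearZ/= mulrBl raddfB/=.
ring.
Qed.

(** The reproducing kernel of the forms of degree n. The adjoint of the derivative along [v],
    applied to the kernel of degree n, evaluates that derivative at [v], which is (n + 1) g(v) by
    Euler's identity. The parity of [k] serves for antipodal nodes. *)
Lemma zonal_kernel n : exists k, [/\ (size k <= n.+1)%N,
  k \Po (- 'X) = (-1) ^+ n *: k &
  forall v g, dot v v = 1 -> g \is n.-homog -> I (zonal v k * g) = ev g v].
Proof.
elim: n => [|n [k [sk pk kI]]].
  exists 1; split; first by rewrite size_poly1.
    by rewrite comp_polyC scale1r.
  move=> v g v1 gn.
  have -> : g = (g@_0)%:MP.
    apply/mpolyP => m; rewrite mcoeffC; have [->|m0] := eqVneq 0%MM m.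
      by rewrite mulr1.
    rewrite mulr0; apply: (dhomog_nemf_coeff gn).
    by rewrite /= mdeg_eq0 eq_sym.
  by rewrite zonal1 mul1r /ev mevalC -alg_mpolyC linearZ/= I1 mulr1.
pose k' := n.+3%:R *: ('X * k) + ('X^2 - 1) * k^`().
have n1 : n.+1%:R != 0 :> R by rewrite pnatr_eq0.
exists (n.+1%:R^-1 *: k'); split.
- rewrite (leq_trans (size_scale_leq _ _))// (leq_trans (size_polyD _ _))//.
  rewrite geq_max (leq_trans (size_scale_leq _ _))/=; last first.
    by rewrite (leq_trans (size_polyMleq _ _))// size_polyX /= ltnS.
  rewrite (leq_trans (size_polyMleq _ _))// -polyC1 size_XnsubC//=.
  case: (posnP (size k)) => [k0|k0].
    by move/eqP: k0; rewrite size_poly_eq0 => /eqP->; rewrite deriv0 size_poly0.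
  have : (size k^`() < size k)%N by rewrite lt_size_deriv// -size_poly_gt0.
  by move=> kk; rewrite add2n !ltnS -ltnS (leq_trans kk sk).
- have pk' : k^`() \Po (- 'X) = (-1) ^+ n.+1 *: k^`().
    have := congr1 (@deriv R) pk.
    rewrite deriv_comp derivN derivX derivZ mulrN1 => H.
    by rewrite exprS mulN1r scaleNr -H opprK.
  have X2 : ('X^2 - 1 : {poly R}) \Po - 'X = 'X^2 - 1.
    by rewrite comp_polyB comp_polyC expr2 comp_polyM comp_polyX mulrNN.
  rewrite comp_polyZ comp_polyD comp_polyZ 2!comp_polyM comp_polyX pk pk' X2.
  by rewrite /k' -!mul_polyC (exprS _ n) polyCM; ring.
move=> v g v1 gn.
rewrite zonalZ -scalerAl linearZ/=.
rewrite -I_zonal_dirder// kI//; last exact: dirder_homog gn.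
by rewrite (dirder_ev _ gn) mulKf.
Qed.

End SphereFunctional.

End Forms.

(** * Values of forms: scaling, dual bases, restriction to lines *)

Section FormsEvaluation.
Variable R : rcfType.
Implicit Types (f g h : {mpoly R[3]}) (u v : 'rV[R]_3) (k : {poly R}).

Lemma ev_scale g n a u : g \is n.-homog -> ev g (a *: u) = a ^+ n * ev g u.
Proof.
move=> /dhomogP gn; rewrite /ev !mevalE mulr_sumr big_seq [RHS]big_seq.
apply: eq_bigr => m /gn /= <-; rewrite mulrCA; congr (_ * _).
rewrite mdegE -prodrXr -big_split/=; apply: eq_bigr => i _.
by rewrite mxE exprMn.
Qed.

Lemma evN g n u : g \is n.-homog -> ev g (- u) = (-1) ^+ n * ev g u.
Proof. by rewrite -scaleN1r; exact: ev_scale. Qed.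

Lemma lin_eq0 u : (lin u == 0) = (u == 0).
Proof.
apply/eqP/eqP => [u0|->]; last by rewrite /lin big1// => i _; rewrite mxE scale0r.
by apply/eqP; rewrite -dotv_eq0 -ev_lin u0; apply/eqP; exact: meval0.
Qed.

Lemma exists_orthogonal u v : exists w, [/\ w != 0, dot u w = 0 & dot v w = 0].
Proof.
have dotE (a b : 'rV[R]_3) : (b *m a^T) 0 0 = dot a b.
  by rewrite mxE; apply: eq_bigr => i _; rewrite mxE mulrC.
have : kermx (row_mx u^T v^T) != 0.
  rewrite -mxrank_eq0 mxrank_ker -lt0n subn_gt0.
  by rewrite (leq_ltn_trans (rank_leq_col _)).
move=> /rowV0Pn[w /sub_kermxP]; rewrite mul_mx_row -[0]row_mx0 => /eq_row_mx[wu wv] w0.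
by exists w; split => //; rewrite -dotE ?wu ?wv mxE.
Qed.

Definition indep3 u v w := forall z, dot u z = 0 -> dot v z = 0 -> dot w z = 0 -> z = 0.

Lemma indep3_dual u v w : indep3 u v w -> exists a b c, forall z,
  z = dot u z *: a + dot v z *: b + dot w z *: c.
Proof.
move=> uvw; pose G : 'M[R]_3 := \matrix_(i, j) tnth [tuple u; v; w] j 0 i.
have GE z j : (z *m G) 0 j = dot (tnth [tuple u; v; w] j) z.
  by rewrite mxE; apply: eq_bigr => i _; rewrite mxE mulrC.
have Gu : G \in unitmx.
  rewrite -row_free_unit -kermx_eq0; apply/rowV0P => z /sub_kermxP zG.
  by apply: uvw; [have := GE z 0|have := GE z 1|have := GE z 2%:R];
    rewrite zG mxE => /esym.
exists (row 0 (invmx G)), (row 1 (invmx G)), (row 2%:R (invmx G)) => z.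
rewrite -[LHS](mulmxK Gu) [LHS]mulmx_sum_row !big_ord_recr big_ord0/= add0r.
rewrite !GE !(tnth_nth 0)/=.
by congr (_ + _ + _); congr (_ *: _); congr (row _ _); apply: val_inj.
Qed.

Definition line g u v : {poly R} :=
  mmap polyC (fun i => (u 0 i)%:P + (v 0 i)%:P * 'X) g.

Lemma lineE g u v t : (line g u v).[t] = ev g (u + t *: v).
Proof.
rewrite /line [mmap _ _ g]/mmap horner_sum /ev mevalE; apply: eq_bigr => m _.
rewrite hornerM hornerC /mmap1 horner_prod; congr (_ * _); apply: eq_bigr => i _.
by rewrite horner_exp !hornerE !mxE mulrC.
Qed.

Lemma size_line g u v n : g \is n.-homog -> (size (line g u v) <= n.+1)%N.
Proof.
move=> /dhomogP gn; rewrite /line [mmap _ _ g]/mmap big_seq.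
apply: (leq_trans (size_sum _ _ _)); apply/bigmax_leqP_seq => m _ /gn/= <-.
rewrite mul_polyC (leq_trans (size_scale_leq _ _))// /mmap1 mdegE.
elim/big_ind2: _ => [|p1 n1 p2 n2 H1 H2|i _]; first by rewrite size_poly1.
  rewrite (leq_trans (size_polyMleq _ _))//.
  by move: H1 H2; case: (size p1) => [|s1] /=; lia.
rewrite (leq_trans (size_poly_exp_leq _ _))// ltnS.
rewrite -{2}(mul1n (m i)) leq_mul2r; apply/orP; right.
have : (size ((u 0 i)%:P + (v 0 i)%:P * 'X)%R <= 2)%N.
  rewrite (leq_trans (size_polyD _ _))// geq_max (leq_trans (size_polyC_leq1 _))//=.
  by rewrite mul_polyC (leq_trans (size_scale_leq _ _))// size_polyX.
by case: size.
Qed.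

Lemma exists_nonroot k (y : nat -> R) : injective y -> k != 0 ->
  exists n, ~~ root k (y n).
Proof.
move=> yi k0; have [/allP H|/allPn[_ /mapP[n _ ->] kn]] :=
  boolP (all (root k) [seq y i | i <- iota 0 (size k)]); last by exists n.
have := max_poly_roots k0 (introT allP H); rewrite size_map size_iota ltnn.
by rewrite map_inj_uniq ?iota_uniq// => /(_ isT).
Qed.

Lemma poly_zero k (y : nat -> R) : injective y -> (forall n, root k (y n)) -> k = 0.
Proof.
move=> yi ky; apply/eqP; apply: contraT => /(exists_nonroot yi)[n].
by rewrite ky.
Qed.

(** The form [p] is taken on the moment curve (1, t, t^2): each nonzero [x i] gives a nonzero
    quadratic in t, so only finitely many t are excluded. *)
Lemma exists_form_nonvanishing N (x : 'I_N -> 'rV[R]_3) :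
  (forall i, x i != 0) -> exists p q r, indep3 p q r /\ forall i, dot p (x i) != 0.
Proof.
move=> x0.
pose P i : {poly R} := (x i 0 0)%:P + (x i 0 1)%:P * 'X + (x i 0 2%:R)%:P * 'X^2.
pose vec (a b c : R) : 'rV[R]_3 := \row_j tnth [tuple a; b; c] j.
have dotE a b c z : dot (vec a b c) z = a * z 0 0 + b * z 0 1 + c * z 0 2%:R.
  rewrite /dot !big_ord_recr big_ord0/= !mxE !(tnth_nth 0)/= add0r.
  congr (_ * z _ _ + _ * z _ _ + _ * z _ _); exact: val_inj.
have P0 i : P i != 0.
  apply: contraNneq (x0 i) => Pi; apply/eqP/rowP => j; rewrite mxE.
  have c0 : (P i)`_0 = 0 by rewrite Pi coef0.
  have c1 : (P i)`_1 = 0 by rewrite Pi coef0.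
  have c2 : (P i)`_2 = 0 by rewrite Pi coef0.
  move: c0 c1 c2; rewrite /P !coefD !coefCM !coefC !coefX !coefXn /=.
  rewrite !mulr0 !mulr1 !addr0 !add0r => c0 c1 c2.
  case: j => -[|[|[|//]]] jlt; [rewrite -[RHS]c0|rewrite -[RHS]c1|rewrite -[RHS]c2];
    congr (x i _ _); exact: val_inj.
have PP0 : \prod_i P i != 0 by apply/prodf_neq0 => i _.
have natI : injective (fun n => n%:R : R) by move=> a b /eqP; rewrite eqr_nat => /eqP.
have [n nP] := exists_nonroot natI PP0; set t := n%:R in nP.
exists (vec 1 t (t ^+ 2)), (vec 0 1 0), (vec 0 0 1); split.
  move=> z; rewrite !dotE !mul0r !mul1r !add0r addr0 => + z1 z2.
  rewrite z1 z2 !mulr0 !addr0 => z0; apply/rowP => j; rewrite mxE.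
  case: j => -[|[|[|//]]] jlt; [rewrite -[RHS]z0|rewrite -[RHS]z1|rewrite -[RHS]z2];
    congr (z _ _); exact: val_inj.
move=> i; apply: contraNneq nP; rewrite dotE mul1r => Pt.
rewrite /root horner_prod (bigD1 i)//=.
rewrite [(P i).[t]](_ : _ = 0) ?mul0r// -Pt /P.
by rewrite !(hornerD, hornerM, hornerC, hornerX, hornerXn); ring.
Qed.

End FormsEvaluation.

(** * Moments on the circles of latitude around a point *)

Section SphereFunctionalMoments.
Variable R : rcfType.
Implicit Types (f g h : {mpoly R[3]}) (u v : 'rV[R]_3) (k : {poly R}).
Variable I : {scalar {mpoly R[3]}}.
Hypothesis I1 : I 1 = 1.
Hypothesis IX : forall i n g, g \is n.-homog ->
  n.+2%:R * I ('X_i * g) = I g^`M(i).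

Let IZ a f : I (a *: f) = a * I f.
Proof. exact: linearZ. Qed.

Let ID f g : I (f + g) = I f + I g.
Proof. exact: raddfD. Qed.

Let IB f g : I (f - g) = I f - I g.
Proof. exact: raddfB. Qed.

(** Euler's identity followed by integration by parts expresses [I g] through second derivatives of
    [g], of degree n - 2; in degree 1 these are derivatives of constants. *)
Lemma I_odd n g : odd n -> g \is n.-homog -> I g = 0.
Proof.
elim/ltn_ind: n g => n IH g on gn.
have n0 : (0 < n)%N by case: n on {IH gn}.
have E : n%:R * I g = \sum_i I ('X_i * g^`M(i)).
  by have := congr1 I (euler gn); rewrite raddf_sum linearZ/= => <-.
apply: (@mulfI _ n%:R); first by rewrite pnatr_eq0 -lt0n.
rewrite mulr0 E big1// => i _.
have dn : g^`M(i) \is n.-1.-homog by exact: mderiv_homog.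
apply: (@mulfI _ n.-1.+2%:R); first by rewrite pnatr_eq0.
rewrite (IX i dn) mulr0; case: n n0 on IH gn {E} dn => [|[|n]]//= _ on IH gn dn.
  by rewrite mderiv_homog0 ?raddf0.
by apply: (IH n) => //; [rewrite negbK in on|exact: mderiv_homog dn].
Qed.

Section Planar.
Variables (b x : 'rV[R]_3).
Hypotheses (x1 : dot x x = 1) (bx : dot b x = 0).
Let r2 := dot b b.

Let homogM j c : lin b ^+ j * lin x ^+ c \is (j + c).-homog.
Proof. by apply: dhomogM; exact: linX_homog. Qed.

Lemma I_axis c : (c.+3)%:R * I (lin x ^+ c.+2) = c.+1%:R * I (lin x ^+ c).
Proof.
have := I_lin IX x (linX_homog x c.+1).
by rewrite -exprS dirder_linX x1 mulr1 linearZ.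
Qed.

Lemma I_planar j c : (j + c + 3)%N%:R * I (lin b ^+ j.+2 * lin x ^+ c) =
  j.+1%:R * r2 * I (lin b ^+ j * lin x ^+ c).
Proof.
have := I_lin IX b (homogM j.+1 c).
rewrite mulrA -exprS dirderM !dirder_linX bx mulr0 scale0r mulr0 addr0.
by rewrite -scalerAl linearZ /= => <-; rewrite addnS addn2 addSn.
Qed.

Lemma I_planar1 c : I (lin b * lin x ^+ c) = 0.
Proof.
apply: (@mulfI _ c.+2%:R); first by rewrite pnatr_eq0.
by rewrite (I_lin IX b (linX_homog x c)) dirder_linX bx mulr0 scale0r raddf0 mulr0.
Qed.

Lemma I_zonal_eq0 h k : (forall c, I (h * lin x ^+ c) = 0) -> I (h * zonal x k) = 0.
Proof.
move=> h0; rewrite -(coefK k) poly_def.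
elim/big_ind: _ => [|k1 k2 H1 H2|i _].
- by rewrite zonal0 mulr0 raddf0.
- by rewrite zonalD mulrDr raddfD/= H1 H2 addr0.
- by rewrite zonalZ zonalXn -scalerAr linearZ/= h0 mulr0.
Qed.

Lemma I_planar_odd j k : odd j -> I (lin b ^+ j * zonal x k) = 0.
Proof.
move=> oj; apply: I_zonal_eq0 => c.
elim/ltn_ind: j oj => -[//|[|j]] IH oj; first by rewrite expr1 I_planar1.
apply: (@mulfI _ (j + c + 3)%N%:R); first by rewrite pnatr_eq0 addn3.
by rewrite I_planar IH ?mulr0//; rewrite /= negbK in oj.
Qed.

(** On the circle of unit vectors u with <x, u> = c, the mean of <b, u>^2 is r2 (1 - c^2) / 2, so
    the first factor has mean zero on every circle of latitude. *)
Lemma I_planar2 k :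
  I ((2%:R *: lin b ^+ 2 - r2 *: (1 - lin x ^+ 2)) * zonal x k) = 0.
Proof.
apply: I_zonal_eq0 => c; rewrite mulrBl -!scalerAl mulrBl mul1r -exprD add2n.
rewrite IB !IZ IB.
have := I_planar 0 c; rewrite expr0 mul1r mul1r; have := I_axis c.
move: (I _) (I _) (I _) => A B C; rewrite -[c.+3]addn3 -[c.+1]addn1 !natrD => H1 H2.
apply: (@mulfI _ (c%:R + 3%:R)); first by rewrite -natrD addn3 pnatr_eq0.
move: (c%:R) H1 H2 => {}c H1 H2.
transitivity (2%:R * ((c + 3%:R) * A) - r2 * ((c + 3%:R) * B - (c + 3%:R) * C)); first by ring.
by rewrite H1 H2; ring.
Qed.

(** Likewise the mean of <b, u>^4 on the circle is 3 r2^2 (1 - c^2)^2 / 8. *)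
Lemma I_planar4 k :
  I ((8%:R *: lin b ^+ 4 - (3%:R * r2 ^+ 2) *: (1 - lin x ^+ 2) ^+ 2) * zonal x k) = 0.
Proof.
apply: I_zonal_eq0 => c.
have -> : (8%:R *: lin b ^+ 4 - (3%:R * r2 ^+ 2) *: (1 - lin x ^+ 2) ^+ 2) * lin x ^+ c =
    8%:R *: (lin b ^+ 4 * lin x ^+ c) -
    (3%:R * r2 ^+ 2) *: (lin x ^+ c - 2%:R *: lin x ^+ c.+2 + lin x ^+ c.+4).
  by rewrite -[c.+4]addn4 -[c.+2]addn2 !exprD -!mul_mpolyC mpolyCMn; ring.
rewrite IB !IZ ID IB IZ.
have := I_planar 2 c; have := I_planar 0 c; rewrite expr0 mul1r mul1r.
have := I_axis c; have := I_axis c.+2.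
rewrite -[c.+2.+3]/(5 + c)%N -[c.+3]/(3 + c)%N -[c.+1]/(1 + c)%N.
move: (I _) (I _) (I _) (I _) (I _) => A B C D E; rewrite  !natrD => H1 H2 H3 H4.
have c3 : c%:R + 3%:R != 0 :> R by rewrite -natrD addn3 pnatr_eq0.
have c5 : c%:R + 5%:R != 0 :> R by rewrite -natrD addnS pnatr_eq0.
move: (c%:R) c3 c5 H1 H2 H3 H4 => {}c c3 c5 H1 H2 H3 H4.
apply: (mulfI c5); apply: (mulfI c3).
transitivity (8%:R * (c + 3%:R) * ((2%:R + c + 3%:R) * A) -
  3%:R * r2 ^+ 2 * ((c + 3%:R) * (c + 5%:R) * C -
    2%:R * (c + 5%:R) * ((3%:R + (0 + c)) * D) +
    (c + 3%:R) * ((5%:R + (0 + c)) * E))); first by ring.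
rewrite H4 H1.
transitivity (24%:R * r2 * ((0 + c + 3%:R) * B) -
  3%:R * r2 ^+ 2 * ((c + 3%:R) * (c + 5%:R) * C -
    2%:R * (c + 5%:R) * ((3%:R + (0 + c)) * D) +
    (c + 3%:R) * ((3%:R + (0 + c)) * D))); first by ring.
by rewrite H3 H2; ring.
Qed.
End Planar.

End SphereFunctionalMoments.

(** * Degree bounds *)

Section Sizes.
Variable R : rcfType.
Implicit Types (f g h : {mpoly R[3]}) (u v : 'rV[R]_3) (k : {poly R}).

Lemma dhomog_msize_le n g : g \is n.-homog -> (msize g <= n.+1)%N.
Proof.
move=> /dhomogP gn; rewrite msizeE; apply/bigmax_leqP_seq => a /gn/= <- _.
by rewrite ltnS.
Qed.

Lemma msizeM_leS f g a b : (msize f <= a.+1)%N -> (msize g <= b.+1)%N ->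
  (msize (f * g) <= (a + b).+1)%N.
Proof.
have [->|f0] := eqVneq f 0; first by rewrite mul0r msize0.
have [->|g0] := eqVneq g 0; first by rewrite mulr0 msize0.
rewrite msizeM//; move: (msize f) (msize g) => [|s] [|t]//=; lia.
Qed.

Lemma msize_zonal v k n : (size k <= n.+1)%N -> (msize (zonal v k) <= n.+1)%N.
Proof.
move=> kn; rewrite -(coefK k) poly_def.
have -> : zonal v (\sum_(i < size k) k`_i *: 'X^i) =
    \sum_(i < size k) k`_i *: lin v ^+ i.
  rewrite (big_morph (zonal v) (zonalD v) (zonal0 v)).
  by apply: eq_bigr => i _; rewrite zonalZ zonalXn.
apply: (leq_trans (msize_sum _ _ _)); apply/bigmax_leqP => i _.
rewrite (leq_trans (msizeZ_le _ _))// (leq_trans (dhomog_msize_le (linX_homog v i)))//.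
exact: (leq_trans (ltn_ord i)).
Qed.

End Sizes.

(* The test functions are nonpositive, resp. nonnegative, on the values of the
   cosines allowed in a regular hexagon. *)
Lemma hexagon_bound (R : realFieldType) (J : finType) (P : pred J) (s : J -> R)
    (j : J) (b : R) : P j -> s j = 1 -> 0 <= b < 2%:R^-1 ->
  (forall l, P l -> -1 <= s l) -> (forall l, P l -> l != j -> s l <= b) ->
  \sum_(l | P l) s l = 0 -> \sum_(l | P l) (2%:R * s l ^+ 2 - 1) = 0 ->
  \sum_(l | P l) s l ^+ 3 = 0 -> \sum_(l | P l) (8%:R * s l ^+ 4 - 3%:R) = 0 ->
  \sum_(l | P l) s l ^+ 5 = 0 -> False.
Proof.
move=> Pj sj /andP[b0 b1] s_ge s_le S1 S2 S3 S4 S5.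
pose c : R := \sum_(l | P l) 1.
(* The test polynomial has mean 3/16 under the moment conditions and value 9/8 at s = 1, so there
   are at least 6 points. *)
have c6 : 9%:R / 8%:R <= c * (3%:R / 16%:R).
  have -> : c * (3%:R / 16%:R) =
      \sum_(l | P l) (1 + s l) * (s l ^+ 2 - 4%:R^-1) ^+ 2.
    rewrite (eq_bigr (fun l => 1 * (3%:R / 16%:R) + s l ^+ 5 +
      (8%:R * s l ^+ 4 - 3%:R) / 8%:R - s l ^+ 3 / 2%:R -
      (2%:R * s l ^+ 2 - 1) / 4%:R + s l / 16%:R)); last by move=> l _; field.
    rewrite !(big_split, sumrN)/= -!mulr_suml S1 S2 S3 S4 S5.
    by rewrite !mul0r !subr0 !addr0.
  rewrite (bigD1 j)//= sj -[leLHS]addr0 lerD//; first by lra.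
  apply: sumr_ge0 => l /andP[Pl _]; apply: mulr_ge0; last exact: sqr_ge0.
  by have := s_ge l Pl; lra.
(* With at least 6 points, the upper bound given by this second polynomial would force b >= 1/2. *)
have : c * (1 - 5%:R / 4%:R * b) <= (1 - b) * (9%:R / 2%:R).
  have -> : c * (1 - 5%:R / 4%:R * b) =
      \sum_(l | P l) (s l - b) * ((s l + 2%:R^-1) ^+ 2 * (s l + 1)).
    rewrite (eq_bigr (fun l => 1 * (1 - 5%:R / 4%:R * b) +
      (8%:R * s l ^+ 4 - 3%:R) / 8%:R + s l ^+ 3 * (2%:R - b) +
      (2%:R * s l ^+ 2 - 1) * (5%:R / 8%:R - b) +
      s l * (4%:R^-1 - 5%:R / 4%:R * b))); last by move=> l _; field.
    rewrite !big_split/= -!mulr_suml S1 S2 S3 S4.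
    by rewrite !mul0r !addr0.
  rewrite (bigD1 j)//= sj -[leRHS]addr0 lerD//; first by lra.
  apply: sumr_le0 => l /andP[Pl lj]; apply: mulr_le0_ge0.
    by rewrite subr_le0 s_le.
  by rewrite mulr_ge0 ?sqr_ge0//; have := s_ge l Pl; lra.
nra.
Qed.

(** * Nodes of a positive formula and forms evaluated at them *)

Section Cubature.
Variable R : rcfType.
Implicit Types (f g h : {mpoly R[3]}) (u v : 'rV[R]_3) (k : {poly R}).
Variable I : {scalar {mpoly R[3]}}.
Hypothesis I1 : I 1 = 1.
Hypothesis IX : forall i n g, g \is n.-homog ->
  n.+2%:R * I ('X_i * g) = I g^`M(i).
Variables (m N : nat) (x : 'I_N -> 'rV[R]_3) (w : 'I_N -> R).
Hypothesis x_inj : injective x.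
Hypothesis x1 : forall i, dot (x i) (x i) = 1.
Hypothesis w0 : forall i, 0 < w i.
Hypothesis exactQ : forall f, (msize f <= (2 * m + 1).+1)%N ->
  I f = \sum_i w i * ev f (x i).

Lemma exact_homog n g : (n <= 2 * m + 1)%N -> g \is n.-homog ->
  I g = \sum_i w i * ev g (x i).
Proof.
by move=> nm gn; apply: exactQ; rewrite (leq_trans (dhomog_msize_le gn)).
Qed.

Definition evn f : 'rV[R]_N := \row_i ev f (x i).

Definition evd n (p : dhomog 3 R n) : 'rV[R]_N := evn (val p).

Lemma evd_is_linear n : linear (@evd n).
Proof. by move=> a p q; apply/rowP => i; rewrite !mxE evD evZ. Qed.

HB.instance Definition _ n :=
  GRing.isLinear.Build R (dhomog 3 R n) 'rV[R]_N _ (@evd n) (@evd_is_linear n).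

(** In the notation of the overview, U is [evs m] and V is [evs m.+1]. *)
Definition evs n : {vspace 'rV[R]_N} :=
  limg (linfun (@evd n)).

Lemma evsP n y : reflect (exists2 g, g \is n.-homog & y = evn g) (y \in evs n).
Proof.
apply: (iffP memv_imgP) => [[p _ ->]|[g gn ->]].
  by exists (val p); rewrite ?lfunE//; exact: dhomog_is_dhomog.
by exists (DHomog gn); rewrite ?memvf// lfunE.
Qed.

(** Products of two forms of degree m are integrated exactly, so a form vanishing at all nodes is
    orthogonal to every form of its degree. *)
Lemma evn_inj g : g \is m.-homog -> evn g = 0 -> g = 0.
Proof.
move=> gm g0; apply: (I_nondeg I1 IX gm) => h hm.
have gh : g * h \is (m + m).-homog by apply: dhomogM.
rewrite (exact_homog _ gh); last by lia.
apply: big1 => i _; move/rowP/(_ i): g0; rewrite !mxE evM => ->.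
by rewrite mul0r mulr0.
Qed.

Lemma dim_evs : \dim (evs m) = 'C(m + 2, m).
Proof.
rewrite limg_dim_eq ?dimvf//; apply/eqP; rewrite -subv0; apply/subvP => p.
rewrite memv_cap memv_ker lfunE/= => /andP[_ /eqP p0]; rewrite memv0.
by apply/eqP/val_inj; apply: evn_inj => //; exact: dhomog_is_dhomog.
Qed.

Lemma evs_orthogonal (y z : 'rV[R]_N) : y \in evs m -> z \in evs m.+1 ->
  \sum_i w i * (y 0 i * z 0 i) = 0.
Proof.
move=> /evsP[g gm ->] /evsP[h hm ->].
have gh : g * h \is (m + m.+1).-homog by apply: dhomogM.
have : I (g * h) = 0 by apply: (I_odd IX _ gh); rewrite addnS/= oddD addbb.
rewrite (exact_homog _ gh); last by lia.
by move=> gh0; rewrite -[RHS]gh0; apply: eq_bigr => i _; rewrite !mxE evM.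
Qed.

(** A vector common to both spaces is orthogonal to itself for the positive weights. *)
Lemma dim_evsS : (\dim (evs m) + \dim (evs m.+1) <= N)%N.
Proof.
rewrite -dimv_disjoint_sum.
  by rewrite (leq_trans (dimvS (subvf _)))// dimvf /dim /= mul1n.
apply/eqP; rewrite -subv0; apply/subvP => y; rewrite memv_cap memv0 => /andP[ym ym1].
have := evs_orthogonal ym ym1 => /psumr_eq0P H; apply/eqP/rowP => i.
have /eqP := H (fun i _ => mulr_ge0 (ltW (w0 i)) (sqr_ge0 (y 0 i))) i isT.
by rewrite mulf_eq0 gt_eqF//= -expr2 sqrf_eq0 mxE => /eqP.
Qed.

Definition same_line i : pred 'I_N := fun j => (x j == x i) || (x j == - x i).

Lemma same_line_refl i : same_line i i.
Proof. by rewrite /same_line eqxx. Qed.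

Definition isolates i g :=
  [/\ g \is m.-homog, ev g (x i) != 0 & forall j, ~~ same_line i j -> ev g (x j) = 0].

(* A form vanishing off the line of [x i] is a multiple of the reproducing
   kernel at [x i], hence zonal on the sphere. *)
Lemma isolates_zonal : exists k, (size k <= m.+1)%N /\ forall i g, isolates i g ->
  exists W, [/\ W = \sum_(j | same_line i j) w j, W * k.[1] = 1 &
    forall v, dot v v = 1 -> ev g v = W * k.[dot v (x i)] * ev g (x i)].
Proof.
have [k [sk pk kI]] := zonal_kernel I1 IX m.
have kN s : k.[- s] = (-1) ^+ m * k.[s].
  by have := congr1 (fun p => p.[s]) pk; rewrite horner_comp hornerZ hornerN hornerX.
exists k; split => // i g [gm gi g0].
pose W := \sum_(j | same_line i j) w j; exists W.
have gE v : dot v v = 1 -> ev g v = W * k.[dot v (x i)] * ev g (x i).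
  move=> v1; rewrite -(kI v g v1 gm) exactQ; last first.
    rewrite mul2n -addnn addn1 ltnW// ltnS.
    exact: (msizeM_leS (msize_zonal _ sk) (dhomog_msize_le gm)).
  rewrite (bigID (same_line i))/= addrC big1 ?add0r => [|j /g0 gj]; last first.
    by rewrite evM gj !mulr0.
  rewrite -mulrA /W mulr_suml; apply: eq_bigr => j; rewrite evM ev_zonal.
  (* At an antipode the kernel and the form both acquire the sign (-1)^m, which cancels in the
     product. *)
  case/orP => /eqP ->//; rewrite dotNr kN (evN _ gm).
  by rewrite mulrACA -exprD addnn -mul2n exprM sqrrN !expr1n mul1r.
split=> //; have := gE _ (x1 i); rewrite x1 => /eqP.
by rewrite -subr_eq0 -{1}[ev g _]mul1r -mulrBl mulf_eq0 (negbTE gi) orbF subr_eq0 => /eqP.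
Qed.

(** The antipodal map exchanges the nodes where [p] is positive with those where it is negative. *)
Lemma antipodal_even : (forall i, exists j, x j = - x i) ->
  forall p, (forall i, dot p (x i) != 0) -> ~~ odd N.
Proof.
move=> anti p p0.
pose a i := odflt i [pick j | x j == - x i].
have aE i : x (a i) = - x i.
  rewrite /a; case: pickP => [j /eqP//|H].
  by have [j ji] := anti i; have := H j; rewrite ji eqxx.
have ainj : injective a.
  by move=> i j ij; apply: x_inj; apply: oppr_inj; rewrite -!aE ij.
pose P := [set i | 0 < dot p (x i)].
have PE : a @: P = ~: P.
  apply/setP => i; rewrite inE inE; apply/imsetP/idP => [[j]|].
    by rewrite inE => Pj ->; rewrite aE dotNr oppr_gt0 -leNgt ltW.
  rewrite -leNgt le_eqVlt (negbTE (p0 i))/= => Pi.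
  exists (a i); first by rewrite inE aE dotNr oppr_gt0.
  by apply: x_inj; rewrite !aE opprK.
have := cardsC P; rewrite -PE card_imset// card_ord => <-.
by rewrite addnn odd_double.
Qed.

(** The ratios q/p and r/p are affine coordinates on the projective plane, so they separate the
    lines through the origin. *)
Lemma same_lineE p q r i j : indep3 p q r -> (forall i, dot p (x i) != 0) ->
  same_line i j = (dot q (x j) / dot p (x j) == dot q (x i) / dot p (x i)) &&
                  (dot r (x j) / dot p (x j) == dot r (x i) / dot p (x i)).
Proof.
move=> pqr p_neq0; apply/orP/andP => [[]/eqP->|[]].
- by rewrite !eqxx.
- by rewrite !dotNr !invrN !mulrNN !eqxx.
rewrite !eqr_div// => /eqP qE /eqP rE.
have : dot p (x i) *: x j - dot p (x j) *: x i = 0.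
  apply: pqr; rewrite dotDr dotNr !dotZr.
  - by rewrite mulrC subrr.
  - by rewrite mulrC qE mulrC subrr.
  - by rewrite mulrC rE mulrC subrr.
move=> /eqP; rewrite subr_eq0 => /eqP xE.
have {}xE : x j = (dot p (x i))^-1 * dot p (x j) *: x i.
  by rewrite -scalerA -xE scalerK.
move: (_ * _) xE => c xE; have := x1 j; rewrite xE dotZl dotZr x1 mulr1 => /eqP.
rewrite -expr2 sqrf_eq1 => /orP[]/eqP->; first by left; rewrite scale1r.
by right; rewrite scaleN1r.
Qed.

(** * Affine chart of a linear form without zeros at the nodes *)

Section Chart.
Variables (p q r : 'rV[R]_3).
Hypothesis pqr : indep3 p q r.
Hypothesis p_neq0 : forall i, dot p (x i) != 0.

Let ratio v : 'rV[R]_N := \row_j (dot v (x j) / dot p (x j)).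
Let inv_p : 'rV[R]_N := \row_j (dot p (x j))^-1.
(** The space p^-1 V of the overview. *)
Let M : {vspace 'rV[R]_N} := (linfun (mulmxr (diag_mx inv_p)) @: evs m.+1)%VS.

Let MP (y : 'rV[R]_N) : reflect (exists2 h, h \is m.+1.-homog &
  forall j, y 0 j = ev h (x j) / dot p (x j)) (y \in M).
Proof.
apply: (iffP memv_imgP) => [[_ /evsP[h hm ->] ->]|[h hm yE]].
  by exists h => // j; rewrite lfunE/= mul_mx_diag !mxE.
exists (evn h); first by apply/evsP; exists h.
by apply/rowP => j; rewrite lfunE/= mul_mx_diag !mxE yE.
Qed.

Let ratioM v y : y \in evs m -> pw (ratio v) y \in M.
Proof.
move=> /evsP[g gm ->]; apply/MP; exists (lin v * g).
  by rewrite -(add1n m); apply: dhomogM gm; exact: lin_homog.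
by move=> j; rewrite pwE !mxE evM ev_lin mulrAC.
Qed.

Let evsM : (evs m <= M)%VS.
Proof.
apply/subvP => u /(ratioM p); congr (_ \in M); apply/rowP => j.
by rewrite pwE mxE mulfV// mul1r.
Qed.

Let dimM : (\dim (evs m) + \dim M <= N)%N.
Proof.
rewrite (leq_trans _ dim_evsS)// leq_add2l.
by rewrite -(limg_ker_dim (linfun (mulmxr (diag_mx inv_p))) (evs m.+1)) leq_addl.
Qed.

Lemma double_dim_evs_le : ('C(m + 2, m) * 2 <= N)%N.
Proof.
by rewrite muln2 -addnn -dim_evs (leq_trans _ dimM)// leq_add2l dimvS.
Qed.

(** An element of U that vanishes at no node: its restriction to the nodes of a line, once known to
    be in U, isolates that line. *)
Let pm := evn (lin p ^+ m).
Let pm_evs : pm \in evs m.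
Proof. by apply/evsP; exists (lin p ^+ m) => //; exact: linX_homog. Qed.

Let pmE j : pm 0 j = dot p (x j) ^+ m.
Proof. by rewrite mxE evX ev_lin. Qed.

Lemma restr_isolates i (P : pred 'I_N) : P =1 same_line i -> restr P pm \in evs m ->
  exists g, isolates i g.
Proof.
move=> PE /evsP[g gm gE]; exists g.
have evE j : ev g (x j) = if same_line i j then dot p (x j) ^+ m else 0.
  by move/rowP/(_ j): gE; rewrite restrE pmE PE mxE => <-.
by split=> // [|j /negbTE ji]; rewrite evE ?ji// same_line_refl expf_neq0.
Qed.

(** Stability puts the restriction of p^m to a line in M; multiplied by p it lies in V, hence is
    orthogonal to p^m. So the sum of w_j p(x_j)^(2m+1) over the line is zero, and since the exponent
    is odd this requires an antipode of equal weight. *)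
Lemma stable_antipodal S : (evs m <= S)%VS -> (S <= M)%VS ->
  pw_stable (ratio q) S -> pw_stable (ratio r) S ->
  forall i, exists j, x j = - x i /\ w j = w i.
Proof.
move=> US SM Sq Sr i.
have := restr_class_stable i Sq Sr (subvP US _ pm_evs).
move=> /(subvP SM)/MP[h hm hE].
have hS : evn h \in evs m.+1 by apply/evsP; exists h.
have {}hE j : ev h (x j) = if same_line i j then dot p (x j) ^+ m.+1 else 0.
  have := hE j; rewrite restrE pmE !mxE -(same_lineE _ _ pqr p_neq0).
  move=> /(congr1 (fun z => z * dot p (x j))).
  by rewrite divfK// => <-; case: ifP; rewrite ?mul0r// exprSr.
have := evs_orthogonal pm_evs hS.
rewrite (bigID (same_line i))/= addrC big1 ?add0r => [|j /negbTE ji]; last first.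
  by rewrite pmE mxE hE ji !mulr0.
rewrite (bigD1 i) ?same_line_refl//= pmE mxE hE same_line_refl -exprD => wE.
have [/existsP[j /eqP ji]|] := boolP [exists j, x j == - x i]; last first.
  rewrite negb_exists => /forallP H; move: wE; rewrite big1 => [|j].
    move=> /eqP; rewrite addr0 mulf_eq0 gt_eqF//=.
    by rewrite expf_eq0 (negbTE (p_neq0 i)) andbF.
  by rewrite /same_line (negbTE (H j)) orbF (inj_eq x_inj) andbN.
exists j; split => //.
have xN : x i != - x i.
  apply/eqP => xi; have := x1 i; rewrite {1}xi dotNl x1 => /eqP.
  by rewrite eqNr oner_eq0.
have jNi : j != i by apply: contraNneq xN => ij; rewrite -ji ij.
move: wE; rewrite (bigD1 j)/=; last by rewrite /same_line ji eqxx orbT.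
rewrite big1 ?addr0 => [|l /andP[/andP[+ li] lj]]; last first.
  by rewrite /same_line -ji !(inj_eq x_inj) (negbTE li) (negbTE lj).
rewrite pmE mxE hE /same_line ji eqxx orbT -exprD dotNr.
rewrite exprNn -signr_odd oddD/= addbN addbb expr1 mulN1r mulrN.
move=> /eqP; rewrite subr_eq0 => /eqP /mulIf -> //.
by rewrite expf_neq0.
Qed.

(** The dimension count leaves U = M, so U itself is preserved by every ratio v/p. *)
Lemma tight_isolates : (N <= 'C(m + 2, m) * 2)%N ->
  (forall i, exists j, x j = - x i /\ w j = w i) /\ forall i, exists g, isolates i g.
Proof.
move=> Nle; have UM : evs m = M.
  apply/eqP; rewrite eqEdim evsM -(leq_add2l (\dim (evs m))).
  by rewrite (leq_trans dimM)// (leq_trans Nle)// dim_evs muln2 addnn.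
have st v : pw_stable (ratio v) (evs m) by apply/pw_stableP => y /ratioM; rewrite -UM.
split; first by apply: (@stable_antipodal (evs m)); rewrite -?UM.
move=> i; apply: (restr_isolates (P := fun j => (ratio q 0 j == ratio q 0 i) &&
  (ratio r 0 j == ratio r 0 i))).
  by move=> j; rewrite (same_lineE _ _ pqr p_neq0) !mxE.
exact: restr_class_stable.
Qed.

Lemma antipodal_or_great_circle : (N <= 'C(m + 2, m) * 2 + 1)%N ->
  (forall i, exists j, x j = - x i) \/
  exists nu s, [/\ indep3 p nu s,
    forall i, dot nu (x i) != 0 -> exists g, isolates i g,
    forall y, y \in evs m -> restr (fun j => dot nu (x j) == 0) y \in evs m &
    exists y, [/\ y \in evs m, pw (ratio s) y \notin evs m &
      forall j, dot nu (x j) != 0 -> y 0 j = 0]].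
Proof.
move=> Nle; have dM : (\dim M <= (\dim (evs m)).+1)%N.
  rewrite -(leq_add2l (\dim (evs m))) (leq_trans dimM)// (leq_trans Nle)//.
  by rewrite dim_evs muln2 -addnn -addnA addn1.
have [[S [US SM Sq Sr]]|] := stable_dichotomy evsM dM (ratioM q) (ratioM r).
  by left => i; have [j [ji _]] := stable_antipodal US SM Sq Sr i; exists j.
move=> [a [b [a' [b' [ab sab [y yU yT]]]]]]; right.
have ratioE c d : c *: ratio q + d *: ratio r = ratio (c *: q + d *: r).
  by apply/rowP => j; rewrite !mxE dotDl !dotZl mulrDl !mulrA.
rewrite ratioE in sab; rewrite ratioE in yT.
set P := _ + _ in sab; set s := _ + _ in yT.
have [c [[y0 [y0U y0T y00]] iso]] := stable_off_fibre evsM dM sab (ratioM s) yU yT.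
(* The exceptional fibre P/p = c consists of the nodes on the great circle nu = 0. *)
pose nu := P - c *: p; exists nu, s.
have nuE j : (dot nu (x j) == 0) = (ratio P 0 j == c).
  rewrite mxE dotDl dotNl dotZl subr_eq0 -[X in _ = (_ == X)](mulfK (p_neq0 j)).
  by rewrite (inj_eq (mulIf _))// invr_eq0.
have pPs : indep3 p P s.
  move=> z pz; rewrite !dotDl !dotZl => Pz sz.
  apply: pqr => //; apply: (mulfI ab); rewrite mulr0.
    transitivity (b' * (a * dot q z + b * dot r z) - b * (a' * dot q z + b' * dot r z)).
      by ring.
    by rewrite Pz sz; ring.
  transitivity (a * (a' * dot q z + b' * dot r z) - a' * (a * dot q z + b * dot r z)).
    by ring.
  by rewrite Pz sz; ring.
split.
- move=> z pz; rewrite dotDl dotNl dotZl pz mulr0 subr0 => Pz sz; exact: pPs.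
- move=> i nui; apply: (restr_isolates (P := fun j => (ratio P 0 j == ratio P 0 i) &&
    (ratio s 0 j == ratio s 0 i))); last by apply: iso => //; rewrite -nuE.
  by move=> j; rewrite (same_lineE _ _ pPs p_neq0) !mxE.
- move=> z zU; have := restr_stable c sab zU; congr (_ \in evs m).
  by apply/rowP => j; rewrite !restrE nuE.
by exists y0; split=> // j; rewrite nuE; exact: y00.
Qed.

End Chart.

(** On the circle, forms of degree m become polynomials of degree at most m in s/p. The form
    isolating a node off the circle gives a nonzero one that vanishes at all nodes of the circle;
    reduction modulo it shows that (s/p) y still comes from a form of degree m. *)
Lemma no_great_circle p nu s : (2 <= m)%N -> indep3 p nu s ->
  (forall i, dot p (x i) != 0) ->
  (forall i, dot nu (x i) != 0 -> exists g, isolates i g) ->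
  (forall y, y \in evs m -> restr (fun j => dot nu (x j) == 0) y \in evs m) ->
  ~ exists y : 'rV[R]_N, [/\ y \in evs m,
      pw (\row_j (dot s (x j) / dot p (x j))) y \notin evs m &
      forall j, dot nu (x j) != 0 -> y 0 j = 0].
Proof.
move=> m2 pnus p0 iso nuU [y [/evsP[g0 g0m ->] yT y0]].
have nu0 : nu != 0.
  have [z [z0 pz sz]] := exists_orthogonal p s.
  apply: contraNneq z0 => nu0; apply/eqP; apply: pnus => //.
  by rewrite nu0 -(scale0r 0) dotZl mul0r.
have nunu : dot nu nu != 0 by rewrite dotv_eq0.
have [k [sk kI]] := isolates_zonal.
(* A node off the great circle [nu = 0] that is not one of its poles. *)
have [i [nui [e [nue ei]]]] : exists i, dot nu (x i) != 0 /\
    exists e, dot nu e = 0 /\ dot e (x i) != 0.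
  have [e [e0 nue _]] := exists_orthogonal nu nu.
  (* A nonzero form of degree m cannot vanish at all nodes; m >= 2 supplies the factor [lin e]. *)
  have gm : lin nu * lin e ^+ m.-1 \is m.-homog.
    have := dhomogM (lin_homog nu) (linX_homog e m.-1).
    by rewrite add1n prednK// ltnW.
  have [/existsP[i]|] := boolP [exists i, ev (lin nu * lin e ^+ m.-1) (x i) != 0].
    rewrite evM evX !ev_lin mulf_eq0 negb_or => /andP[nui ei].
    exists i; split=> //; exists e; split=> //; apply: contraNneq ei => ->.
    by rewrite expr0n; case: m m2 => [|[|]].
  rewrite negb_exists => /forallP H.
  have : evn (lin nu * lin e ^+ m.-1) = 0.
    by apply/rowP => i; rewrite !mxE; apply/eqP; have := H i; rewrite negbK.
  move=> /(evn_inj gm)/eqP; rewrite mulf_eq0 expf_eq0 !lin_eq0.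
  by rewrite (negbTE nu0) (negbTE e0) andbF.
have [g iso_g] := iso i nui; have [W [_ W1 gE]] := kI i g iso_g.
have [gm gi g_off] := iso_g.
have W0 : W != 0 by apply: contra_eq_neq W1 => ->; rewrite mul0r eq_sym oner_eq0.
have k0 : k != 0.
  by apply: contra_eq_neq W1 => ->; rewrite horner0 mulr0 eq_sym oner_eq0.
(* [g] is proportional to [k(<v, x i>)], and [<v, x i>] takes infinitely many
   values on the great circle. *)
have [v [v1 nuv gv]] : exists v, [/\ dot v v = 1, dot nu v = 0 & ev g v != 0].
  pose e1 := x i - (dot nu (x i) / dot nu nu) *: nu.
  have nue1 : dot nu e1 = 0 by rewrite dotDr dotNr dotZr divfK// subrr.
  have xe1 : dot (x i) e1 = dot e1 e1.
    by rewrite [in RHS]dotDl dotNl dotZl nue1 mulr0 subr0.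
  have e10 : e1 != 0.
    apply: contraNneq ei => e10; have := congr1 (dot e) e10.
    rewrite dotDr dotNr dotZr (dotC e nu) nue mulr0 subr0 => ->.
    by rewrite dotC -(scale0r 0) dotZl mul0r.
  have a_gt0 : 0 < dot e1 e1 by rewrite lt_neqAle dotv_ge0 eq_sym dotv_eq0 e10.
  have a_le1 : dot e1 e1 <= 1.
    rewrite -xe1 dotDr dotNr dotZr x1 (dotC (x i) nu) lerBlDr lerDl.
    by rewrite mulrAC -expr2 divr_ge0 ?sqr_ge0 ?dotv_ge0.
  have [f [f0 nuf e1f]] := exists_orthogonal nu e1.
  have xf : dot (x i) f = 0.
    have := e1f; rewrite dotDl dotNl dotZl nuf mulr0 subr0; exact.
  have b_gt0 : 0 < dot f f by rewrite lt_neqAle dotv_ge0 eq_sym dotv_eq0 f0.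
  (* The vector v = al e1 + be f will be a unit vector of the circle with <v, x i> = al |e1|^2; al =
     1/(n + 1) yields infinitely many values, one of which is not a root of [k]. *)
  have yI : injective (fun n => n.+1%:R^-1 * dot e1 e1).
    move=> n1 n2 /(mulIf (lt0r_neq0 a_gt0))/invr_inj/eqP.
    by rewrite eqr_nat => /eqP[].
  have [n kn] := exists_nonroot yI k0.
  pose al : R := n.+1%:R^-1.
  have al_le1 : al ^+ 2 * dot e1 e1 <= 1.
    rewrite mulr_ile1 ?dotv_ge0 ?sqr_ge0// exprn_ile1// ?invr_ge0//.
    by rewrite invf_le1 ?ler1n.
  pose be := Num.sqrt ((1 - al ^+ 2 * dot e1 e1) / dot f f).
  have beE : be ^+ 2 * dot f f = 1 - al ^+ 2 * dot e1 e1.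
    by rewrite sqr_sqrtr ?divfK ?lt0r_neq0// divr_ge0 ?dotv_ge0 ?subr_ge0.
  pose v := al *: e1 + be *: f.
  have v1 : dot v v = 1.
    rewrite dotDl !dotDr !dotZl !dotZr (dotC f e1) e1f !mulr0 addr0 add0r.
    by rewrite !mulrA -!expr2 beE addrC subrK.
  exists v; split=> //; first by rewrite dotDr !dotZr nue1 nuf !mulr0 addr0.
  rewrite gE//.
  rewrite !mulf_neq0// (_ : dot _ (x i) = al * dot e1 e1)//.
  by rewrite dotC dotDr !dotZr xf mulr0 addr0 xe1.
(* The basis dual to p, nu, s: a node on the circle is p(x) (A + tau B) with tau = s/p. *)
have [A [C [B ABC]]] := indep3_dual pnus.
pose tau j := dot s (x j) / dot p (x j).
have xE j : dot nu (x j) = 0 -> x j = dot p (x j) *: (A + tau j *: B).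
  move=> nuj; rewrite {1}(ABC (x j)) nuj scale0r addr0 scalerDr scalerA.
  by rewrite mulrC divfK.
have evE h j : h \is m.-homog -> dot nu (x j) = 0 ->
    ev h (x j) = dot p (x j) ^+ m * (line h A B).[tau j].
  by move=> hm nuj; rewrite lineE {1}xE// (ev_scale _ _ hm).
pose p1 := line g A B.
have p1_tau j : dot nu (x j) = 0 -> p1.[tau j] = 0.
  move=> nuj; have : ev g (x j) = 0.
    apply: g_off; apply: contra nui => /orP[]/eqP xj; move: nuj; rewrite xj.
      by move=> ->.
    by rewrite dotNr => /eqP; rewrite oppr_eq0.
  by rewrite evE// => /eqP; rewrite mulf_eq0 expf_eq0 (negbTE (p0 j)) andbF => /eqP.
have p1_neq0 : p1 != 0.
  (* As p(v) may be 0, [g] is followed along s(v) B + t A: it vanishes at infinitely many t, hence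
     identically, in particular at t = p(v), where the point is v. *)
  apply: contraNneq gv => p10; pose q := line g (dot s v *: B) A.
  have natI : injective (fun n => n.+1%:R : R).
    by move=> n1 n2 /eqP; rewrite eqr_nat => /eqP[].
  have q0 : q = 0.
    apply: (poly_zero natI) => n; rewrite /root lineE; set t := n.+1%:R.
    have t0 : t != 0 by rewrite pnatr_eq0.
    have -> : dot s v *: B + t *: A = t *: (A + (dot s v / t) *: B).
      by rewrite scalerDr scalerA mulrC divfK// addrC.
    by rewrite (ev_scale _ _ gm) -lineE -/p1 p10 horner0 mulr0.
  have := congr1 (fun r => r.[dot p v]) q0; rewrite lineE horner0 addrC => /eqP.
  by rewrite {3}(ABC v) nuv scale0r addr0.
(* Multiplying by s/p can raise the degree to m + 1; the remainder has the same values at the nodes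
   of the circle and is small enough to be homogenized in degree m. *)
pose Q := ('X * line g0 A B) %% p1.
have sQ : (size Q <= m.+1)%N.
  by rewrite ltnW// (leq_trans (ltn_modpN0 _ p1_neq0))// size_line.
have Q_tau j : dot nu (x j) = 0 -> Q.[tau j] = tau j * (line g0 A B).[tau j].
  move=> nuj; have := congr1 (fun r => r.[tau j]) (divp_eq ('X * line g0 A B) p1).
  by rewrite hornerD [X in _ = X + _]hornerM p1_tau// mulr0 add0r hornerM hornerX.
pose h := \sum_(l < m.+1) Q`_l *: (lin s ^+ l * lin p ^+ (m - l)).
have hm : h \is m.-homog.
  apply: rpred_sum => l _; apply: rpredZ.
  have := dhomogM (linX_homog s l) (linX_homog p (m - l)).
  by rewrite subnKC// -ltnS.
have hE j : ev h (x j) = dot p (x j) ^+ m * Q.[tau j].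
  rewrite /ev raddf_sum/= (horner_coef_wide _ sQ) mulr_sumr; apply: eq_bigr => l _.
  rewrite -/(ev _ _) evZ evM !evX !ev_lin /tau expr_div_n.
  rewrite -[X in _ = _ ^+ X * _](subnKC (_ : l <= m)%N) -1?ltnS// exprD.
  by field; rewrite expf_neq0.
case/negP: yT; have : evn h \in evs m by apply/evsP; exists h.
move=> /nuU; congr (_ \in evs m); apply/rowP => j; rewrite restrE pwE !mxE.
case: eqP => [nuj|/eqP nuj]; last by move: (y0 _ nuj); rewrite mxE => ->; rewrite mulr0.
by rewrite hE Q_tau// evE// -/(tau j) mulrCA.
Qed.

Lemma x_neq0 i : x i != 0.
Proof. by rewrite -dotv_eq0 x1 oner_eq0. Qed.

Lemma nodes_ge : ('C(m + 2, m) * 2 <= N)%N.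
Proof.
have [p [q [r [pqr p0]]]] := exists_form_nonvanishing x_neq0.
exact: double_dim_evs_le p0.
Qed.

Lemma nodes_neq : (2 <= m)%N -> N <> ('C(m + 2, m) * 2 + 1)%N.
Proof.
move=> m2 NE; have [p [q [r [pqr p0]]]] := exists_form_nonvanishing x_neq0.
have [anti|[nu [s [pnus iso nuU yT]]]] :
    _ \/ _ := antipodal_or_great_circle pqr p0 (eq_leq NE).
  by have := antipodal_even anti p0; rewrite NE addn1 /= negbK muln2 odd_double.
exact: (no_great_circle m2 pnus p0 iso nuU yT).
Qed.

Lemma dot_eq1 i j : dot (x i) (x j) = 1 -> i = j.
Proof.
move=> ij; apply: x_inj; apply/eqP; rewrite -subr_eq0 -dotv_eq0.
rewrite dotDl !dotDr !dotNl !dotNr !x1 (dotC (x j)) ij.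
by rewrite subrr opprK addNr addr0.
Qed.

Lemma nodes_not_tight : (3 <= m)%N -> N <> ('C(m + 2, m) * 2)%N.
Proof.
move=> m3 NE; have [p [q0 [r [pqr p0]]]] := exists_form_nonvanishing x_neq0.
have [anti iso] := tight_isolates pqr p0 (eq_leq NE).
have [k [sk kI]] := isolates_zonal.
have xN i : x i != - x i.
  by rewrite -addr_eq0 -mulr2n -scaler_nat scaler_eq0 pnatr_eq0 (negbTE (x_neq0 i)).
(* Each line carries exactly two nodes, of equal weight, so the total weight W is 2 w and W k(1) = 1
   determines it. *)
have w_eq i : w i = (2%:R * k.[1])^-1.
  have [g iso_g] := iso i; have [W [WE W1 _]] := kI i g iso_g.
  have [j [ji wji]] := anti i.
  have WE2 : W = 2%:R * w i.
    rewrite WE (bigD1 i) ?same_line_refl//= (bigD1 j)/=; last first.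
      by rewrite /same_line ji eqxx orbT/= -(inj_eq x_inj) ji eq_sym.
    rewrite big1 ?addr0 => [|l /andP[/andP[+ li] lj]]; last first.
      by rewrite /same_line -ji !(inj_eq x_inj) (negbTE li) (negbTE lj).
    by rewrite wji -mulr2n mulr_natl.
  have k1 : k.[1] != 0 by apply: contra_eq_neq W1 => ->; rewrite mulr0 eq_sym oner_eq0.
  rewrite WE2 in W1; rewrite invfM; apply: (mulIf k1); rewrite divfK//.
  by apply: (@mulfI _ 2%:R); rewrite ?pnatr_eq0// mulrA W1 mulfV// pnatr_eq0.
have k_dot i j : ~~ same_line i j -> k.[dot (x i) (x j)] = 0.
  move=> ij; have [g iso_g] := iso i; have [W [WE W1 gE]] := kI i g iso_g.
  have [gm gi g_off] := iso_g; have := gE _ (x1 j); rewrite g_off// => /esym/eqP.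
  have W0 : W != 0 by apply: contra_eq_neq W1 => ->; rewrite mul0r eq_sym oner_eq0.
  by rewrite !mulf_eq0 (negbTE W0) (negbTE gi) orbF dotC => /eqP.
have N2 : (2 < N)%N.
  rewrite NE; have : (1 < 'C(m + 2, m))%N; last by lia.
  rewrite -{2}(addnK 2 m) bin_sub ?leq_addl// addn2 bin2.
  by case: m m3 => [|[|[|n]]]//= _; nia.
pose i0 : 'I_N := Ordinal (ltnW (ltnW N2)).
have w_neq0 : (2%:R * k.[1])^-1 != 0 :> R by rewrite -(w_eq i0) lt0r_neq0.
have exists_off i : exists l, ~~ same_line i l.
  have [j [ji _]] := anti i.
  have [/existsP//|] := boolP [exists l, ~~ same_line i l].
  rewrite negb_exists => /forallP H.
  have : (#|'I_N| <= #|[set i; j]|)%N.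
    apply/subset_leq_card/subsetP => l _; have := H l; rewrite negbK /same_line -ji.
    by rewrite !(inj_eq x_inj) inE !inE.
  by rewrite card_ord cards2 leqNgt (leq_ltn_trans _ N2)//; case: (_ != _).
have [[i j] /= ij ij_max] : exists2 ij : 'I_N * 'I_N, ij.1 != ij.2 &
    forall i' j', i' != j' -> dot (x i') (x j') <= dot (x ij.1) (x ij.2).
  have [l0 il0] := exists_off i0.
  have P0 : (i0, l0).1 != (i0, l0).2.
    by apply: contraNneq il0 => /= <-; exact: same_line_refl.
  case: (@Order.TotalTheory.arg_maxP _ _ ('I_N * 'I_N)%type (i0, l0)
    (fun ij => ij.1 != ij.2) (fun ij => dot (x ij.1) (x ij.2)) P0) => ij Pij ij_max.
  by exists ij => // i' j' ij'; exact: (ij_max (i', j')).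
set t := dot (x i) (x j) in ij_max.
(* Replacing a node off the line of [x i] by its antipode changes the sign of the inner product, and
   both signs are bounded by [t]. *)
have t_ge0 : 0 <= t.
  have [l il] := exists_off i; have [l' [ll' _]] := anti l.
  have := ij_max i l; have := ij_max i l'; rewrite ll' dotNr => H1 H2.
  have {}H1 : - dot (x i) (x l) <= t.
    by apply: H1; apply: contraNneq il => ->; rewrite /same_line ll' opprK eqxx orbT.
  have {}H2 : dot (x i) (x l) <= t.
    by apply: H2; apply: contraNneq il => ->; exact: same_line_refl.
  by have := lerD H1 H2; rewrite addNr -mulr2n pmulrn_lge0.
have t_lt1 : t < 1.
  rewrite lt_neqAle; apply/andP; split.
    by apply: contraNneq ij => /dot_eq1->.
  have := dotv_ge0 (x i - x j).
  rewrite dotDl !dotDr !dotNl !dotNr !x1 (dotC (x j)) -/t; lra.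
have ij_off : ~~ same_line i j.
  rewrite /same_line negb_or (inj_eq x_inj) eq_sym ij/=.
  by apply/eqP => xj; move: t_ge0; rewrite /t xj dotNr x1; lra.
(* The component of [x j] orthogonal to [x i], and its squared length. *)
pose b := x j - t *: x i; pose r2 := 1 - t ^+ 2.
have bx : dot b (x i) = 0 by rewrite dotDl dotNl dotZl x1 mulr1 dotC subrr.
have bl l : dot b (x l) = dot (x j) (x l) - t * dot (x i) (x l).
  by rewrite dotDl dotNl dotZl.
have bb : dot b b = r2.
  by rewrite {2}/b dotDr dotNr dotZr bx mulr0 subr0 bl x1 -/t -expr2.
have r2_gt0 : 0 < r2 by rewrite /r2; nra.
move: b bx bl bb => b bx bl bb.
(* Dividing the full power of 'X - t out of [k] leaves [q] of degree at most m - 1, nonzero at t and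
   zero at the other latitudes. *)
have [mu [q qt kE]] := multiplicity_XsubC k t.
have k_neq0 : k != 0.
  have := w_neq0; apply: contraNneq => ->; rewrite horner0 mulr0 invr0; exact: eqxx.
rewrite k_neq0/= in qt.
have mu_gt0 : (0 < mu)%N.
  have := k_dot i j ij_off; rewrite -/t kE; case: mu {kE} => //.
  by rewrite expr0 mulr1 => /eqP; rewrite -[_ == 0]/(root q t) (negbTE qt).
have sq : (size q <= (m - 1).+1)%N.
  have qn0 : q != 0 by apply: contraNneq k_neq0 => q0'; rewrite kE q0' mul0r.
  move: sk; rewrite kE size_Mmonic ?monic_exp ?monicXsubC// size_exp_XsubC.
  by move: (size q) => sz; lia.
have q_dot l : ~~ same_line i l -> dot (x i) (x l) != t -> q.[dot (x i) (x l)] = 0.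
  move=> il lt; have := k_dot i l il; rewrite kE hornerM horner_exp hornerXsubC.
  by move=> /eqP; rewrite mulf_eq0 expf_eq0 subr_eq0 (negbTE lt) andbF orbF => /eqP.
pose P l := dot (x i) (x l) == t.
(* The degree of the integrand is at most 5 + (m - 1), which is within 2m + 1 because m >= 3. Only
   the nodes of latitude t contribute, with constant weight and constant [q]. *)
have sumP F : (msize F <= 6)%N -> ev F (x i) = 0 -> ev F (- x i) = 0 ->
    I (F * zonal (x i) q) = 0 -> \sum_(l | P l) ev F (x l) = 0.
  move=> sF Fi FNi; rewrite exactQ; last first.
    have := msizeM_leS (sF : (_ <= 5.+1)%N) (msize_zonal (x i) sq).
    by move=> /leq_trans; apply; lia.
  rewrite (bigID P)/= [X in _ + X]big1 ?addr0 => [|l Pl]; last first.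
    rewrite evM; have [/orP[]/eqP->|il] := boolP (same_line i l).
    - by rewrite Fi mul0r mulr0.
    - by rewrite FNi mul0r mulr0.
    - by rewrite ev_zonal q_dot// !mulr0.
  rewrite (eq_bigr (fun l => ((2%:R * k.[1])^-1 * q.[t]) * ev F (x l))).
    rewrite -mulr_sumr => /eqP.
    by rewrite !mulf_eq0 (negbTE w_neq0) -[_ == 0]/(root q t) (negbTE qt) => /eqP.
  by move=> l /eqP Pl; rewrite w_eq evM ev_zonal Pl -mulrA (mulrC q.[t]).
(* For a node of latitude t, the cosine of its angle to [x j] measured on the latitude circle. *)
pose s l := dot b (x l) / r2.
have sE l : dot b (x l) = r2 * s l by rewrite mulrC divfK// lt0r_neq0.
have bxN : dot b (- x i) = 0 by rewrite dotNr bx oppr0.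
have sum_odd d : odd d -> (d <= 5)%N -> \sum_(l | P l) s l ^+ d = 0.
  move=> od d5; have d0 : (0 < d)%N by case: d od {d5}.
  have : \sum_(l | P l) ev (lin b ^+ d) (x l) = 0.
    apply: sumP; rewrite ?evX ?ev_lin ?bx ?bxN ?expr0n ?gtn_eqF//.
      exact: (leq_trans (dhomog_msize_le (linX_homog b d))).
    exact: (I_planar_odd IX).
  rewrite (eq_bigr (fun l => r2 ^+ d * s l ^+ d)); last first.
    by move=> l _; rewrite evX ev_lin sE exprMn.
  rewrite -mulr_sumr => /eqP; rewrite mulf_eq0 expf_eq0 (gt_eqF r2_gt0) andbF.
  by move=> /eqP.
have msize_1z2 : (msize (1 - lin (x i) ^+ 2) <= 3)%N.
  rewrite (leq_trans (msizeD_le _ _))// geq_max msize1 mmeasureN/=.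
  exact: (dhomog_msize_le (linX_homog (x i) 2)).
have ev1 u : ev 1 u = 1 by exact: meval1.
pose F2 := 2%:R *: lin b ^+ 2 - dot b b *: (1 - lin (x i) ^+ 2).
have F2E u : ev F2 u = 2%:R * dot b u ^+ 2 - r2 * (1 - dot (x i) u ^+ 2).
  by rewrite evB !evZ evB ev1 !evX !ev_lin bb.
have sum2 : \sum_(l | P l) (2%:R * s l ^+ 2 - 1) = 0.
  have : \sum_(l | P l) ev F2 (x l) = 0.
    apply: sumP; rewrite ?F2E ?bx ?bxN ?dotNr ?x1 ?sqrrN.
    - apply: (leq_trans (msizeD_le _ _)); rewrite geq_max mmeasureN.
      apply/andP; split; apply: (leq_trans (msizeZ_le _ _)).
        exact: (leq_trans (dhomog_msize_le (linX_homog b 2))).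
      exact: (leq_trans msize_1z2).
    - by ring.
    - by ring.
    - exact: (I_planar2 IX).
  rewrite (eq_bigr (fun l => r2 ^+ 2 * (2%:R * s l ^+ 2 - 1))); last first.
    by move=> l /eqP Pl; rewrite F2E Pl sE /r2; ring.
  rewrite -mulr_sumr => /eqP; rewrite mulf_eq0 expf_eq0 (gt_eqF r2_gt0) andbF.
  by move=> /eqP.
pose F4 := 8%:R *: lin b ^+ 4 - (3%:R * dot b b ^+ 2) *: (1 - lin (x i) ^+ 2) ^+ 2.
have F4E u : ev F4 u = 8%:R * dot b u ^+ 4 - 3%:R * r2 ^+ 2 * (1 - dot (x i) u ^+ 2) ^+ 2.
  by rewrite evB !evZ !evX evB ev1 !evX !ev_lin bb.
have sum4 : \sum_(l | P l) (8%:R * s l ^+ 4 - 3%:R) = 0.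
  have : \sum_(l | P l) ev F4 (x l) = 0.
    apply: sumP; rewrite ?F4E ?bx ?bxN ?dotNr ?x1 ?sqrrN.
    - apply: (leq_trans (msizeD_le _ _)); rewrite geq_max mmeasureN.
      apply/andP; split; apply: (leq_trans (msizeZ_le _ _)).
        exact: (leq_trans (dhomog_msize_le (linX_homog b 4))).
      by rewrite expr2; exact: (leq_trans (msizeM_leS msize_1z2 msize_1z2)).
    - by ring.
    - by ring.
    - exact: (I_planar4 IX).
  rewrite (eq_bigr (fun l => r2 ^+ 4 * (8%:R * s l ^+ 4 - 3%:R))); last first.
    by move=> l /eqP Pl; rewrite F4E Pl sE /r2; ring.
  rewrite -mulr_sumr => /eqP; rewrite mulf_eq0 expf_eq0 (gt_eqF r2_gt0) andbF.
  by move=> /eqP.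
have t1 : 0 < 1 + t by lra.
(* Maximality of t gives s l <= (t - t^2) / (1 - t^2) = t / (1 + t), below 1/2 since t < 1. *)
apply: (@hexagon_bound _ _ P s j (t / (1 + t))).
- by rewrite /P eqxx.
- by rewrite /s bl x1 -/t -expr2 divff// lt0r_neq0.
- by rewrite divr_ge0//= ?(ltW t1)// ltr_pdivrMr//; lra.
- move=> l /eqP Pl; have := dotv_ge0 (x l - t *: x i - s l *: b).
  rewrite !(dotDl, dotDr, dotNl, dotNr, dotZl, dotZr) (dotC (x l) b) (dotC (x i) b).
  rewrite (dotC (x l) (x i)) !x1 bx bb sE Pl => H.
  have : r2 * s l ^+ 2 <= r2 * 1 by rewrite /r2 in H *; nra.
  by rewrite ler_pM2l// => H1; nra.
- move=> l /eqP Pl lj; rewrite /s bl Pl ler_pdivrMr// /r2.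
  have -> : t / (1 + t) * (1 - t ^+ 2) = t - t * t by field; rewrite lt0r_neq0.
  by rewrite lerD2r ij_max// eq_sym.
- by rewrite -[RHS](sum_odd 1%N)//; apply: eq_bigr => l _; rewrite expr1.
- exact: sum2.
- exact: sum_odd.
- exact: sum4.
- exact: sum_odd.
Qed.

End Cubature.

(** * The functional with prescribed moments *)

Section MomentFunctional.
Variables (R : rcfType) (mom : 'X_{1..3} -> R).
Implicit Types (f g : {mpoly R[3]}).

Definition of_moments f : R := \sum_(a <- msupp f) f@_a * mom a.

(** The support depends on [f]; a range of exponents shared by several polynomials makes linearity
    visible. *)
Lemma of_momentswE f n : (msize f <= n)%N ->
  of_moments f = \sum_(a : 'X_{1..3 < n}) f@_a * mom a.
Proof.
pose J : subFinType _ := 'X_{1..3 < n}.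
move=> fn; rewrite /of_moments (ssrcomplements.big_mksub J) //=; first last.
- by move=> a /msize_mdeg_lt /leq_trans; apply.
- by rewrite msupp_uniq.
rewrite big_rmcond //= => i.
by move/memN_msupp_eq0 ->; rewrite mul0r.
Qed.

Lemma of_moments_is_scalar : scalar of_moments.
Proof.
move=> c f g; pose n := maxn (msize (c *: f + g)) (maxn (msize f) (msize g)).
rewrite !(@of_momentswE _ n) ?leq_max ?leqnn ?orbT//.
rewrite mulr_sumr -big_split; apply: eq_bigr => a _ /=.
by rewrite mcoeffD mcoeffZ mulrDl mulrA.
Qed.

HB.instance Definition _ :=
  GRing.isLinear.Build R {mpoly R[3]} R *%R of_moments of_moments_is_scalar.

Lemma of_momentsX a : of_moments 'X_[a] = mom a.
Proof. by rewrite /of_moments msuppX big_seq1 mcoeffX eqxx mul1r. Qed.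

End MomentFunctional.

(** By linearity monomials suffice. The truncation in [a - U_(i)] is harmless: when [a i] is 0 so is
    the coefficient. *)
Lemma I_mderiv (R : rcfType) (I : {scalar {mpoly R[3]}}) :
  (forall i a, (mdeg a).+2%:R * I 'X_[(a + U_(i))] = (a i)%:R * I 'X_[(a - U_(i))]) ->
  forall i n g, g \is n.-homog -> n.+2%:R * I ('X_i * g) = I g^`M(i).
Proof.
move=> IU i n g /dhomogP gn.
have -> : g^`M(i) = \sum_(a <- msupp g) (g@_a *: 'X_[a])^`M(i).
  by rewrite {1}(mpolyE g) linear_sum.
rewrite {1}(mpolyE g) mulr_sumr !linear_sum/= mulr_sumr.
rewrite big_seq [RHS]big_seq; apply: eq_bigr => a /gn/= <-.
rewrite -scalerAr linearZ/= mderivZ mderivX scalerA linearZ/= -mpolyXD.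
by rewrite addmC mulrCA IU mulrA.
Qed.

Lemma cubature_bound (R : rcfType) (mom : 'X_{1..3} -> R) (m N : nat)
    (x : 'I_N -> 'rV[R]_3) (w : 'I_N -> R) :
  mom 0%MM = 1 ->
  (forall i a, (mdeg a).+2%:R * mom (a + U_(i))%MM = (a i)%:R * mom (a - U_(i))%MM) ->
  (2 <= m)%N -> injective x -> (forall i, dot (x i) (x i) = 1) -> (forall i, 0 < w i) ->
  (forall a, (mdeg a <= 2 * m + 1)%N -> \sum_i w i * ev 'X_[a] (x i) = mom a) ->
  [/\ ((m + 1) * (m + 2) <= N)%N, N <> ((m + 1) * (m + 2) + 1)%N &
      (3 <= m)%N -> N <> ((m + 1) * (m + 2))%N].
Proof.
move=> mom0 momr m2 x_inj x1 w0 wE.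
have exactI f : (msize f <= (2 * m + 1).+1)%N ->
    of_moments mom f = \sum_i w i * ev f (x i).
  move=> sf; transitivity (\sum_(a <- msupp f) \sum_i w i * (f@_a * ev 'X_[a] (x i))).
    rewrite /of_moments big_seq [RHS]big_seq; apply: eq_bigr => a af.
    rewrite -wE; last by rewrite -ltnS (leq_trans (msize_mdeg_lt af)).
    by rewrite mulr_sumr; apply: eq_bigr => i _; rewrite mulrCA.
  rewrite exchange_big; apply: eq_bigr => i _ /=; rewrite -mulr_sumr; congr (_ * _).
  rewrite [in RHS](mpolyE f) /ev raddf_sum; apply: eq_bigr => a _ /=.
  by rewrite mevalZ.
have I1 : of_moments mom 1 = 1 by rewrite -(mpolyX0 _ R) of_momentsX.
have IX : forall i n g, g \is n.-homog ->
    n.+2%:R * of_moments mom ('X_i * g) = of_moments mom g^`M(i).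
  by apply: I_mderiv => i a; rewrite /= !of_momentsX.
have cardE : ('C(m + 2, m) * 2 = (m + 1) * (m + 2))%N.
  rewrite -{2}(addnK 2 m) bin_sub ?leq_addl//.
  have := bin_ffact (m + 2) 2; rewrite addn2 addn1 !ffactnS ffactn0 muln1 /=.
  by rewrite mulnC => ->; rewrite mulnC.
rewrite -cardE; split.
- exact: (nodes_ge I1 IX x1 w0 exactI).
- exact: (nodes_neq I1 IX x_inj x1 w0 exactI).
- move=> m3; exact: (nodes_not_tight I1 IX x_inj x1 w0 exactI).
Qed.

Definition monomial (R : rcfType) (a b c : nat) : Poly3.poly3 R :=
  'X_[ [multinom tnth [tuple a; b; c] i | i < 3] ].

Lemma ord3P (P : 'I_3 -> Prop) : P 0 -> P 1 -> P 2%:R -> forall i, P i.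
Proof.
by move=> P0 P1 P2 [[|[|[|//]]] i3]; [move: P0|move: P1|move: P2];
  congr P; exact: val_inj.
Qed.

Lemma prod3E (T : comPzRingType) (F : 'I_3 -> T) : \prod_i F i = F 0 * F 1 * F 2%:R.
Proof.
by rewrite !big_ord_recr big_ord0 /= mul1r; congr (F _ * F _ * F _); exact: val_inj.
Qed.

Lemma mdeg3E (a : 'X_{1..3}) : mdeg a = (a 0%R + a 1%R + a 2%:R%R)%N.
Proof.
rewrite mdegE !big_ord_recr big_ord0 /= add0n.
by congr (a _ + a _ + a _)%N; exact: val_inj.
Qed.

Lemma monomial_degree (R : rcfType) a b c t : (a + b + c <= t)%N ->
  Poly3.degree_le t (monomial R a b c).
Proof. by rewrite /Poly3.degree_le msizeX mdeg3E !mnmE !(tnth_nth 0%N). Qed.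

Lemma monomial_eval (R : rcfType) a b c (y : 3.-tuple R) :
  Poly3.eval (monomial R a b c) y = tnth y 0 ^+ a * tnth y 1 ^+ b * tnth y 2%:R ^+ c.
Proof. by rewrite /Poly3.eval mevalX prod3E !mnmE !(tnth_nth 0%N). Qed.

(** Integration by parts on monomials, split by variable: the vanishing conditions treat exponent 0
    in the chosen variable, the recurrences the positive exponents. *)
Lemma cubature_bound_tuple (R : rcfType) (M : nat -> nat -> nat -> R) (m N : nat)
    (x : 'I_N -> 3.-tuple R) (w : 'I_N -> R) :
  M 0 0 0 = 1 ->
  (forall b c, M 1 b c = 0) -> (forall a c, M a 1 c = 0) -> (forall a b, M a b 1 = 0) ->
  (forall a b c, (a + b + c + 3)%:R * M a.+2 b c = a.+1%:R * M a b c) ->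
  (forall a b c, (a + b + c + 3)%:R * M a b.+2 c = b.+1%:R * M a b c) ->
  (forall a b c, (a + b + c + 3)%:R * M a b c.+2 = c.+1%:R * M a b c) ->
  (2 <= m)%N -> injective x ->
  (forall i, \sum_(j < 3) tnth (x i) j ^+ 2 = 1) -> (forall i, 0 < w i) ->
  (forall a b c, (a + b + c <= 2 * m + 1)%N ->
     \sum_i w i * (tnth (x i) 0 ^+ a * tnth (x i) 1 ^+ b * tnth (x i) 2%:R ^+ c) = M a b c) ->
  [/\ ((m + 1) * (m + 2) <= N)%N, N <> ((m + 1) * (m + 2) + 1)%N &
      (3 <= m)%N -> N <> ((m + 1) * (m + 2))%N].
Proof.
move=> M0 M1l M1m M1r Ml Mm Mr m2 x_inj x1 w0 wE.
pose mom (a : 'X_{1..3}) := M (a 0%R) (a 1%R) (a 2%:R%R).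
pose y i : 'rV[R]_3 := \row_j tnth (x i) j.
apply: (@cubature_bound R mom m N y w) => //.
- by rewrite /mom !mnm0E.
- move=> i; elim/ord3P: i => a;
    rewrite /mom mdeg3E !(mnmDE, mnmBE, mnm1E)/= !addn0 !subn0 addn1.
  + case: (a 0%R) => [|n]; first by rewrite M1l mul0r mulr0.
    by rewrite subn1 /= -Ml; congr (_%:R * _); lia.
  + case: (a 1%R) => [|n]; first by rewrite M1m mul0r mulr0.
    by rewrite subn1 /= -Mm; congr (_%:R * _); lia.
  + case: (a 2%:R%R) => [|n]; first by rewrite M1r mul0r mulr0.
    by rewrite subn1 /= -Mr; congr (_%:R * _); lia.
- move=> i j /rowP ij; apply: x_inj; apply: eq_from_tnth => k.
  by have := ij k; rewrite !mxE.
- move=> i; rewrite -[RHS](x1 i); apply: eq_bigr => j _.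
  by rewrite mxE expr2.
- move=> a; rewrite mdeg3E /mom => /wE <-; apply: eq_bigr => i _; congr (_ * _).
  by rewrite /ev mevalX prod3E !mxE.
Qed.

End SphereForms.

(** * Moments of the surface measure *)

From mathcomp Require Import all_classical all_reals all_analysis.
From mathcomp Require Import measurable_realfun.
Import numFieldNormedType.Exports.

Local Open Scope classical_set_scope.
Local Open Scope ring_scope.

(** * Integrals of trigonometric monomials *)

Section TrigIntegrals.
Variable R : realType.
Notation mu := (@lebesgue_measure R).
Implicit Types (a b : nat) (l x : R).

Definition trig a b : R -> R := fun x => cos x ^+ a * sin x ^+ b.
Definition trig_integral l a b : R := (\int[mu]_(x in `[0%R, l]) trig a b x)%R.

(** A predecessor truncated at 0 always comes with coefficient 0. *)
Lemma is_derive_trig a b x : is_derive x 1 (trig a b)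
  (b%:R * trig a.+1 b.-1 x - a%:R * trig a.-1 b.+1 x).
Proof.
have -> : trig a b = (@cos R ^+ a) * (@sin R ^+ b).
  by apply/funext => y; rewrite mulrfctE !exprfctE.
apply: is_derive_eq; rewrite !exprfctE /trig /GRing.scale/= !exprS; ring.
Qed.

Lemma continuous_trig a b : continuous (trig a b).
Proof.
move=> x; apply: differentiable_continuous; apply/derivable1_diffP.
by have [] := is_derive_trig a b x.
Qed.

Lemma integrable_continuous_itv l (f : R -> R) : continuous f ->
  mu.-integrable `[0, l] (EFin \o f).
Proof.
move=> cf; apply: continuous_compact_integrable; first exact: segment_compact.
by apply: continuous_subspaceT => x; exact: cf.
Qed.

Lemma integrable_trig l a b : mu.-integrable `[0, l] (EFin \o trig a b).
Proof. exact/integrable_continuous_itv/continuous_trig. Qed.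

Lemma trig_integral_ibp l a b : 0 < l ->
  b%:R * trig_integral l a.+1 b.-1 - a%:R * trig_integral l a.-1 b.+1 =
  trig a b l - trig a b 0.
Proof.
move=> l0; have mI : measurable (`[0, l] : set R) by [].
pose f x := b%:R * trig a.+1 b.-1 x - a%:R * trig a.-1 b.+1 x.
have fE : (\int[mu]_(x in `[0%R, l]) f x)%R = trig a b l - trig a b 0.
  rewrite /Rintegral (@continuous_FTC2 _ f (trig a b) 0 l)//.
  - apply: continuous_subspaceT => x; apply: cvgB; apply: cvgMr; exact: continuous_trig.
  - split=> [x _||].
    + by have [] := is_derive_trig a b x.
    + exact/cvg_at_right_filter/continuous_trig.
    + exact/cvg_at_left_filter/continuous_trig.
  - by move=> x _; rewrite derive1E; apply: derive_val; exact: is_derive_trig.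
rewrite -fE /trig_integral -!RintegralZl ?integrable_trig// -RintegralB//.
- by apply: integrable_continuous_itv => x; apply: cvgMr; exact: continuous_trig.
- by apply: integrable_continuous_itv => x; apply: cvgMr; exact: continuous_trig.
Qed.

Lemma trig_integral_pyth l a b :
  trig_integral l a.+2 b + trig_integral l a b.+2 = trig_integral l a b.
Proof.
rewrite /trig_integral -RintegralD ?integrable_trig//.
apply: eq_Rintegral => x _; rewrite /trig -[RHS]mul1r -(cos2Dsin2 x) !exprS; ring.
Qed.

Section Period.
Variable l : R.
Hypotheses (l0 : 0 < l) (sinl : sin l = 0).

(** The boundary terms carry a positive power of the sine, which vanishes at both ends; [l] is meant
    to be pi or 2 pi. *)
Let ibp a b : b.+1%:R * trig_integral l a.+1 b = a%:R * trig_integral l a.-1 b.+2.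
Proof.
apply/eqP; rewrite -subr_eq0 (trig_integral_ibp a b.+1 l0) /trig sinl sin0.
by rewrite !expr0n/= !mulr0 subrr.
Qed.

Lemma trig_integral_cos1 b : trig_integral l 1 b = 0.
Proof.
by have /eqP := ibp 0 b; rewrite mul0r mulf_eq0 pnatr_eq0 => /eqP.
Qed.

Lemma trig_integral_cosSS a b :
  (a + b + 2)%:R * trig_integral l a.+2 b = a.+1%:R * trig_integral l a b.
Proof.
rewrite -(trig_integral_pyth l a b) mulrDr -(ibp a.+1 b) -mulrDl -natrD.
by congr (_%:R * _); lia.
Qed.

Lemma trig_integral_sinSS a b :
  (a + b + 2)%:R * trig_integral l a b.+2 = b.+1%:R * trig_integral l a b.
Proof.
rewrite -(trig_integral_pyth l a b) mulrDr (ibp a.+1 b) -mulrDl -natrD.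
by congr (_%:R * _); lia.
Qed.

Lemma trig_integral_sin1 a : cos l = 1 -> trig_integral l a 1 = 0.
Proof.
move=> cosl; have := trig_integral_ibp a.+1 0 l0.
rewrite mul0r sub0r /trig sinl cosl sin0 cos0 !expr1n subrr => /eqP.
by rewrite oppr_eq0 mulf_eq0 pnatr_eq0 => /eqP.
Qed.

End Period.
End TrigIntegrals.

(** * Recurrences for the moments in spherical coordinates *)

Section SphereMoments.
Variable R : realType.
Notation mu := (@lebesgue_measure R).

(** The integral of x^a y^b z^c over the sphere, factored into azimuth and polar angle; the extra
    sine comes from the area element. *)
Definition moment (a b c : nat) : R :=
  trig_integral (pi *+ 2) a b * trig_integral pi c (a + b).+1 / (pi *+ 4).

Let pi2_gt0 : 0 < (pi : R) *+ 2. Proof. by rewrite mulrn_wgt0// pi_gt0. Qed.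
Let sin2pi0 : sin ((pi : R) *+ 2) = 0. Proof. exact: sin2pi. Qed.

Lemma moment1l b c : moment 1 b c = 0.
Proof. by rewrite /moment trig_integral_cos1// !mul0r. Qed.

Lemma moment1m a c : moment a 1 c = 0.
Proof. by rewrite /moment trig_integral_sin1// ?mul0r// cos2pi. Qed.

Lemma moment1r a b : moment a b 1 = 0.
Proof. by rewrite /moment (trig_integral_cos1 (pi_gt0 R) (sinpi R)) mulr0 mul0r. Qed.

Let polar c n : (c + n + 3)%:R * trig_integral (pi : R) c n.+3 =
  n.+2%:R * trig_integral pi c n.+1.
Proof.
rewrite -(trig_integral_sinSS (pi_gt0 R) (sinpi R)).
by congr (_%:R * _); lia.
Qed.

(** The azimuthal factor gains (a + 1) / (a + b + 2) and the polar factor (a + b + 2) / (a + b + c +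
    3), so a + b + 2 cancels. *)
Lemma momentSSl a b c :
  (a + b + c + 3)%:R * moment a.+2 b c = a.+1%:R * moment a b c.
Proof.
have H1 := trig_integral_cosSS pi2_gt0 sin2pi0 a b.
have H2 := polar c (a + b).
rewrite /moment !addSn; set J := trig_integral _ _ _ in H1 *.
set S := trig_integral _ _ _ in H2 *; set J' := trig_integral _ _ _ in H1 *.
set S' := trig_integral _ _ _ in H2 *.
have -> : (a + b + c + 3)%N = (c + (a + b) + 3)%N by lia.
have n0 : (a + b + 2)%:R != 0 :> R by rewrite pnatr_eq0; lia.
rewrite !mulrA; congr (_ / _); apply: (mulfI n0).
transitivity (((a + b + 2)%:R * J) * ((c + (a + b) + 3)%:R * S)); first by ring.
by rewrite H1 H2 addn2; ring.
Qed.

Lemma momentSSm a b c :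
  (a + b + c + 3)%:R * moment a b.+2 c = b.+1%:R * moment a b c.
Proof.
have H1 := trig_integral_sinSS pi2_gt0 sin2pi0 a b.
have H2 := polar c (a + b).
have e : (a + b.+2 = (a + b).+2)%N by lia.
rewrite /moment e; set J := trig_integral _ _ _ in H1 *.
set S := trig_integral _ _ _ in H2 *; set J' := trig_integral _ _ _ in H1 *.
set S' := trig_integral _ _ _ in H2 *.
have -> : (a + b + c + 3)%N = (c + (a + b) + 3)%N by lia.
have n0 : (a + b + 2)%:R != 0 :> R by rewrite pnatr_eq0; lia.
rewrite !mulrA; congr (_ / _); apply: (mulfI n0).
transitivity (((a + b + 2)%:R * J) * ((c + (a + b) + 3)%:R * S)); first by ring.
by rewrite H1 H2 addn2; ring.
Qed.

Lemma momentSSr a b c :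
  (a + b + c + 3)%:R * moment a b c.+2 = c.+1%:R * moment a b c.
Proof.
rewrite /moment mulrCA !mulrA; congr (_ / _); rewrite -mulrA mulrCA.
have := trig_integral_cosSS (pi_gt0 R) (sinpi R) c (a + b).+1.
have -> : (c + (a + b).+1 + 2)%N = (a + b + c + 3)%N by lia.
by move=> <-; rewrite -mulrA; congr (_ * _); rewrite mulrC.
Qed.

(** Fubini's theorem for the two functions extended by zero off their intervals, which replaces the
    rectangle by the plane. *)
Lemma integral_rect_prod (F G : R -> R) (s t : R) : continuous F -> continuous G ->
  (\int[mu \x mu]_(u in `[0%R, s] `*` `[0%R, t]) (F u.1 * G u.2)%:E =
   ((\int[mu]_(x in `[0%R, s]) F x)%R * (\int[mu]_(x in `[0%R, t]) G x)%R)%:E)%E.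
Proof.
move=> cF cG.
pose A : set (measurableTypeR R) := `[0%R, s]%classic.
pose B : set (measurableTypeR R) := `[0%R, t]%classic.
have mA : measurable A by exact: measurable_itv.
have mB : measurable B by exact: measurable_itv.
have iF : mu.-integrable setT (EFin \o (F \_ A)).
  rewrite -restrict_EFin; apply: (iffLR (integrable_mkcond _ _)) => //.
  exact: integrable_continuous_itv.
have iG : mu.-integrable setT (EFin \o (G \_ B)).
  rewrite -restrict_EFin; apply: (iffLR (integrable_mkcond _ _)) => //.
  exact: integrable_continuous_itv.
have mF : measurable_fun setT (F \_ A) by move/measurable_int : iF => /measurable_EFinP.
have mG : measurable_fun setT (G \_ B) by move/measurable_int : iG => /measurable_EFinP.
pose f u := ((F \_ A) u.1 * (G \_ B) u.2)%:E.
have mf : measurable_fun setT f.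
  apply/measurable_EFinP; apply: measurable_funM.
    exact: (measurableT_comp mF).
  exact: (measurableT_comp mG).
transitivity (\int[mu \x mu]_u f u)%E.
  rewrite integral_mkcond; apply: eq_integral => -[x y] _; rewrite /f patchE/= !patchE.
  have -> : ((x, y) \in A `*` B) = (x \in A) && (y \in B).
    by apply/idP/andP => [/set_mem[? ?]|[/set_mem ? /set_mem ?]]; [split|]; apply/mem_set.
  by case: (x \in A); case: (y \in B) => //=; rewrite ?mul0r ?mulr0.
have GE : (\int[mu]_y ((G \_ B) y)%:E = (\int[mu]_(x in B) G x)%R%:E)%E.
  have finK : (\int[mu]_(x in B) (G x)%:E)%E \is a fin_num.
    by apply: integrable_fin_num => //; exact: integrable_continuous_itv.
  rewrite /Rintegral (fineK finK) [RHS]integral_mkcond.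
  by apply: eq_integral => y _; rewrite !patchE; case: ifP.
have FE : (\int[mu]_y ((F \_ A) y)%:E = (\int[mu]_(x in A) F x)%R%:E)%E.
  have finK : (\int[mu]_(x in A) (F x)%:E)%E \is a fin_num.
    by apply: integrable_fin_num => //; exact: integrable_continuous_itv.
  rewrite /Rintegral (fineK finK) [RHS]integral_mkcond.
  by apply: eq_integral => y _; rewrite !patchE; case: ifP.
have intf : (mu \x mu)%E.-integrable setT f.
  apply/integrable12ltyP => //.
  have iGa : mu.-integrable setT (fun y => `|(G \_ B) y|%:E) by exact: integrable_norm iG.
  have iFa : mu.-integrable setT (fun x => `|(F \_ A) x|%:E) by exact: integrable_norm iF.
  rewrite (eq_integral (fun x =>
    `|(F \_ A) x|%:E * \int[mu]_y `|(G \_ B) y|%:E)%E); last first.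
    move=> x _; rewrite -integralZl//; apply: eq_integral => y _.
    by rewrite -EFinM -normrM.
  have : (\int[mu]_y `|(G \_ B) y|%:E)%E \is a fin_num by exact: integrable_fin_num.
  move=> /fineK <-; rewrite integralZr//.
  rewrite ltey_eq fin_numM//.
  exact: integrable_fin_num.
rewrite -(integral12_prod_meas1 intf) /fubini_F/=.
rewrite (eq_integral (fun x => ((F \_ A) x)%:E * (\int[mu]_(x in B) G x)%R%:E)%E); last first.
  by move=> x _; rewrite -GE -integralZl.
by rewrite integralZr// FE -EFinM.
Qed.

End SphereMoments.

(** * Integration over the sphere through the chart *)

Section SphereIntegral.
Variable R : realType.
Notation mu := (@lebesgue_measure R).
Notation mu2 := (mu \x mu)%E.
Notation sigma := (sphere_measure R).
Notation chart := (@sphere_chart R).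
Notation density := (@sphere_density R).
Notation D := (chart_domain R).

Let mD : measurable D. Proof. exact: measurable_chart_domain. Qed.
Let mchart : measurable_fun setT chart. Proof. exact: measurable_sphere_chart. Qed.
Let mdensity : measurable_fun setT density.
Proof. exact: measurable_sphere_density. Qed.

Import HBNNSimple.

(** First stage of the change of variables, immediate from the definition of the measure; simple
    functions and monotone limits follow. *)
Let sphere_indic (E : set (3.-tuple R)) : measurable E ->
  (\int[sigma]_y (\1_E y)%:E = \int[mu2]_(u in D) ((\1_E (chart u))%:E * (density u)%:E))%E.
Proof.
move=> mE; rewrite integral_indic//= setIT /sphere_measure.
rewrite [LHS]integral_mkcond [RHS]integral_mkcond.
apply: eq_integral => u _; rewrite !patchE in_setI.
case: (u \in D) => //=; rewrite indicE -[(u \in _)]/(chart u \in E).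
by case: (chart u \in E); rewrite ?mul1e ?mul0e.
Qed.

Let density_ge0 u : D u -> (0 <= (density u)%:E)%E.
Proof. by move=> Du; rewrite lee_fin sphere_density_ge0. Qed.

Let mdensityE A : measurable_fun A (fun u => (density u)%:E).
Proof. by apply/measurable_EFinP; apply: measurable_funTS. Qed.

Let sphere_nnsfun (f : {nnsfun 3.-tuple R >-> R}) :
  (\int[sigma]_y (f y)%:E = \int[mu2]_(u in D) ((f (chart u))%:E * (density u)%:E))%E.
Proof.
under [LHS]eq_integral do rewrite fimfunE -fsumEFin//.
rewrite [LHS]ge0_integral_fsum//; last 2 first.
  - by move=> r; exact/measurable_EFinP/measurableT_comp.
  - by move=> n x _; rewrite EFinM nnfun_muleindic_ge0.
under [RHS]eq_integral.
  move=> x xD; rewrite fimfunE -fsumEFin// ge0_mule_fsuml; last first.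
    by move=> r; rewrite EFinM nnfun_muleindic_ge0.
  over.
rewrite [RHS]ge0_integral_fsum//; last 2 first.
  - move=> r; apply: emeasurable_funM; last exact: mdensityE.
    apply/measurable_EFinP; apply: measurable_funTS.
    by apply: measurable_funM => //; exact: measurableT_comp.
  - move=> n x Dx; apply: mule_ge0; last exact: density_ge0.
    by rewrite EFinM nnfun_muleindic_ge0.
apply: eq_fsbigr => r _; rewrite integralZl_indic_nnsfun//= sphere_indic//.
have [r0|r0] := leP 0 r; last first.
  rewrite preimage_nnfun0// [RHS]integral0_eq ?[X in (_ * X)%E]integral0_eq ?mule0//.
    by move=> u _; rewrite indic0 mul0e.
  by move=> u _; rewrite indic0 mulr0 mul0e.
have mE : measurable_fun D (fun u => (\1_(f @^-1` [set r]) (chart u))%:E : \bar R).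
  by apply/measurable_EFinP; apply: measurable_funTS; exact: measurableT_comp.
rewrite -ge0_integralZl//; last 2 first.
- by apply: emeasurable_funM; [exact: mE|exact: mdensityE].
- by move=> u Du; apply: mule_ge0; [rewrite lee_fin|exact: density_ge0].
by apply: eq_integral => u _; rewrite EFinM muleA.
Qed.

Lemma sphere_integral_ge0 (f : 3.-tuple R -> \bar R) :
  measurable_fun setT f -> (forall y, 0 <= f y)%E ->
  (\int[sigma]_y f y = \int[mu2]_(u in D) (f (chart u) * (density u)%:E))%E.
Proof.
move=> mf f0.
pose f_ := nnsfun_approx measurableT mf.
transitivity (limn (fun n => \int[sigma]_y (f_ n y)%:E)%E).
  rewrite -monotone_convergence//=.
  - apply: eq_integral => y /[!inE] _; apply/esym/cvg_lim => //=.
    exact: cvg_nnsfun_approx.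
  - by move=> n; exact/measurable_EFinP/measurable_funTS.
  - by move=> n ? _; rewrite lee_fin.
  - by move=> ? _ ? ? mn; rewrite lee_fin; exact/lefP/nd_nnsfun_approx.
under eq_fun do rewrite sphere_nnsfun.
rewrite -monotone_convergence//=.
- apply: eq_integral => u /[!inE] Du; apply/cvg_lim => //=.
  apply: cvgeZr => //; exact: cvg_nnsfun_approx.
- move=> n; apply: emeasurable_funM; last exact: mdensityE.
  apply/measurable_EFinP; apply: measurable_funTS.
  exact: measurableT_comp.
- by move=> k u Du; rewrite mule_ge0 ?density_ge0// lee_fin.
- move=> u Du n1 n2 n12; rewrite lee_wpmul2r ?density_ge0// lee_fin.
  exact/lefP/nd_nnsfun_approx.
Qed.

Lemma measurable_tnth_exp (i : 'I_3) n :
  measurable_fun setT (fun y : 3.-tuple R => tnth y i ^+ n).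
Proof. by apply: measurable_funX; exact: measurable_tnth. Qed.

Lemma measurable_sphere2 : measurable (sphere2 R).
Proof.
have mf : measurable_fun setT (fun y : 3.-tuple R => \sum_(i < 3) tnth y i ^+ 2).
  by apply: measurable_sum => i; exact: measurable_tnth_exp.
rewrite -[sphere2 R]setTI; exact: (mf measurableT _ (measurable_set1 1)).
Qed.

Lemma sphere_chartP u : sphere2 R (chart u).
Proof.
case: u => a b; rewrite /sphere2/= !big_ord_recl big_ord0 /= /tnth/=.
by have := cos2Dsin2 a; have := cos2Dsin2 b; nra.
Qed.

(** Positive and negative parts are treated separately: the density is nonnegative on the chart
    domain, so it commutes with taking them. *)
Lemma sphere_integral (h : 3.-tuple R -> R) : measurable_fun setT h ->
  (\int[sigma]_(y in sphere2 R) (h y)%:E =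
   \int[mu2]_(u in D) (h (chart u) * density u)%:E)%E.
Proof.
move=> mh; rewrite integral_mkcond.
pose f := ((fun y => (h y)%:E) \_ (sphere2 R))%E.
have mf : measurable_fun setT f.
  apply/(measurable_restrictT _ measurable_sphere2).
  by apply/measurable_EFinP; apply: measurable_funTS.
rewrite [LHS]integralE [RHS]integralE.
rewrite !sphere_integral_ge0//; last 2 first.
  exact: measurable_funeneg.
  exact: measurable_funepos.
congr (_ - _)%E; apply: eq_integral => u /set_mem Du.
  rewrite !funeposE !patchE mem_set; last exact: sphere_chartP.
  rewrite -!EFin_max -EFinM maxr_pMl ?mul0r//.
  by rewrite -lee_fin; exact: density_ge0.
rewrite !funenegE !patchE mem_set; last exact: sphere_chartP.
rewrite -!EFinN -!EFin_max -EFinM maxr_pMl ?mul0r ?mulNr//.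
by rewrite -lee_fin; exact: density_ge0.
Qed.

Lemma sphere_moment a b c :
  (\int[sigma]_(y in sphere2 R)
     (tnth y 0 ^+ a * tnth y 1 ^+ b * tnth y 2%:R ^+ c)%:E = (moment R a b c)%:E)%E.
Proof.
rewrite (@sphere_integral (fun y =>
    tnth y 0 ^+ a * tnth y 1 ^+ b * tnth y 2%:R ^+ c)); last first.
  by do 2?apply: measurable_funM; exact: measurable_tnth_exp.
pose F (x : R) := trig c (a + b).+1 x * (pi *+ 4)^-1.
have cF : continuous F by move=> x; apply: cvgMl; exact: continuous_trig.
transitivity (\int[mu2]_(u in D) (F u.1 * trig a b u.2)%:E)%E.
  apply: eq_integral => -[x y] _; congr (_%:E).
  rewrite /F /trig /sphere_chart /sphere_density !(tnth_nth 0)/=.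
  by rewrite !exprMn exprS exprD; ring.
rewrite integral_rect_prod//; last exact: continuous_trig.
rewrite /F RintegralZr//; last exact: integrable_trig.
by congr (_%:E); rewrite /moment /trig_integral mulrC mulrA.
Qed.

End SphereIntegral.

(** * The bounds for the surface measure *)

Lemma positive_cubature_bound (R : realType) (m N : nat)
    (x : 'I_N -> 3.-tuple R) (w : 'I_N -> R) :
  (2 <= m)%N -> positive_cubature (2 * m + 1) x w ->
  [/\ (node_bound m <= N)%N, N <> (node_bound m + 1)%N &
      (3 <= m)%N -> N <> node_bound m].
Proof.
move=> m2 [x_inj x1 w0 wE].
apply: (@SphereForms.cubature_bound_tuple R (moment R) m N x w) => //.
- apply: EFin_inj; rewrite -sphere_moment -[RHS]sphere_measure_sphere2.
  rewrite -[RHS]mul1e -(integral_cst _ (@measurable_sphere2 R)).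
  by apply: eq_integral => y _; rewrite !expr0 !mulr1.
- exact: moment1l.
- exact: moment1m.
- exact: moment1r.
- exact: momentSSl.
- exact: momentSSm.
- exact: momentSSr.
- move=> a b c abc; apply: EFin_inj; rewrite -sphere_moment.
  have := wE _ (SphereForms.monomial_degree R abc).
  under eq_integral do rewrite SphereForms.monomial_eval.
  by move=> ->; congr (_%:E); apply: eq_bigr => i _; rewrite SphereForms.monomial_eval.
Qed.

Theorem theorem1p1 (R : realType) :
  (forall m : nat, (2 <= m)%N ->
     forall (N : nat) (x : 'I_N -> 3.-tuple R) (w : 'I_N -> R),
       positive_cubature (2 * m + 1) x w ->
       (node_bound m <= N)%N /\ N <> (node_bound m + 1)%N)
  /\ (forall m : nat, (3 <= m)%N ->
       (((node_bound m + 2)%N%:R)%:E <= min_nodes R (2 * m + 1))%E).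
Proof.
split=> [m m2 N x w Q|m m3].
  by have [] := positive_cubature_bound m2 Q.
apply: le_ereal_inf_tmp => _ [N [x [w Q]] <-].
have [Nge N1 N0] := positive_cubature_bound (ltnW m3) Q.
rewrite lee_fin ler_nat; have := N0 m3; lia.
Qed.
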